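(* Let $A$ be a Krull domain, let $(a,b)\in A^2$, and let $A'=A[X]/(aX-b)$, where $A[X]$ is the polynomial ring in one variable $X$ over $A$. Let $P(A,(a,b))$ denote the set of prime elements $p$ of $A$ such that $a\in pA$ and $pA+bA\neq A$. Assume that the following four conditions hold: (i) $a,b$ are nonzero and relatively prime (i.e. $aA\cap bA=abA$), and $a$ is either a unit of $A$ or a product of prime elements of $A$; (ii) $pA+bA$ is a prime ideal of $A$ for every $p\in P(A,(a,b))$; (iii) $q\notin pA+bA$ for every pair $p,q\in P(A,(a,b))$ of non-associate elements; (iv) $\bigcap_{i\ge 0}(pA+bA)^i=(0)$ for every $p\in P(A,(a,b))$. Then: (a) $A'$ is a Krull domain and $\mathrm{Cl}(A')\cong \mathrm{Cl}(A)$; (b) $A'$ is a UFD if and only if $A$ is a UFD.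
   Context: $\mathrm{Cl}(R)$ denotes the divisor class group of a Krull domain $R$ (the free abelian group on height-one primes modulo principal divisors). *)

(* Defs.v *)
From HB Require Import structures.
From Stdlib Require List.
From mathcomp Require Import all_boot all_order all_algebra.
Set Implicit Arguments. Unset Strict Implicit. Unset Printing Implicit Defensive.
Import GRing.Theory.
Local Open Scope ring_scope.

Section CommAlg.
Variable R : comPzRingType.

Definition dvdR (x y : R) : Prop := exists z, y = x * z.
Definition unitR (x : R) : Prop := dvdR x 1.
Definition assocR (x y : R) : Prop := dvdR x y /\ dvdR y x.

Definition is_domain : Prop :=
  (1 != 0 :> R) /\ forall x y : R, x * y = 0 -> x = 0 \/ y = 0.

Definition prime_elt (p : R) : Prop :=
  p <> 0 /\ ~ unitR p /\ forall x y, dvdR p (x * y) -> dvdR p x \/ dvdR p y.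

Definition irreducible_elt (p : R) : Prop :=
  p <> 0 /\ ~ unitR p /\ forall x y, p = x * y -> unitR x \/ unitR y.

Definition ideal (I : R -> Prop) : Prop :=
  I 0 /\ (forall x y, I x -> I y -> I (x + y)) /\ (forall r x, I x -> I (r * x)).

Definition prime_ideal (I : R -> Prop) : Prop :=
  ideal I /\ ~ I 1 /\ forall x y, I (x * y) -> I x \/ I y.

Definition gen2 (p b : R) : R -> Prop := fun z => exists x y, z = p * x + b * y.

Definition ideal_mul (I J : R -> Prop) : R -> Prop := fun x =>
  exists ps : seq (R * R), (forall q, List.In q ps -> I q.1 /\ J q.2) /\
     x = \sum_(q <- ps) q.1 * q.2.

Fixpoint ideal_pow (I : R -> Prop) (n : nat) : R -> Prop :=
  match n with
  | 0 => fun _ => True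
  | n'.+1 => ideal_mul I (ideal_pow I n')
  end.

Definition height_one (P : R -> Prop) : Prop :=
  prime_ideal P /\ (exists x, P x /\ x <> 0) /\
  forall Q, prime_ideal Q -> (exists x, Q x /\ x <> 0) ->
     (forall x, Q x -> P x) -> forall x, P x -> Q x.

(* n-th symbolic power P^(n) = P^n R_P \cap R *)
Definition symb_pow (P : R -> Prop) (n : nat) (x : R) : Prop :=
  exists s, ~ P s /\ ideal_pow P n (s * x).

Definition ordP (P : R -> Prop) (x : R) (n : nat) : Prop :=
  symb_pow P n x /\ ~ symb_pow P n.+1 x.

Definition divisor (D : (R -> Prop) -> int) : Prop :=
  (forall P, ~ height_one P -> D P = 0) /\
  exists s : list (R -> Prop), forall P, D P <> 0 -> List.In P s.

Definition div_of (x : R) (D : (R -> Prop) -> int) : Prop :=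
  (forall P, ~ height_one P -> D P = 0) /\
  forall P, height_one P -> exists n : nat, ordP P x n /\ D P = n%:Z.

(* principal divisors: div(x/y) = div x - div y, x, y nonzero *)
Definition principal_div (D : (R -> Prop) -> int) : Prop :=
  exists x y Dx Dy, x <> 0 /\ y <> 0 /\ div_of x Dx /\ div_of y Dy /\
     forall P, D P = Dx P - Dy P.

(* Krull domain (Krull's definition, cf. Matsumura Sec. 12): R is a domain
   and there is a family of discrete valuations v_i of Frac(R) (given by
   their restrictions to R \ {0}, nat-valued, nontrivial) such that
   R = Frac(R) \cap \bigcap_i R_{v_i}, and every nonzero x has v_i(x) <> 0
   for only finitely many i. *)
Definition krull : Prop :=
  is_domain /\
  exists (I : Type) (v : I -> R -> nat),
    (forall i x y, x <> 0 -> y <> 0 -> v i (x * y) = (v i x + v i y)%N) /\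
    (forall i (x y : R), x <> 0 -> y <> 0 -> x + y <> 0 ->
        (minn (v i x) (v i y) <= v i (x + y)%R)%N) /\
    (forall i, exists x, x <> 0 /\ (0 < v i x)%N) /\
    (forall x, x <> 0 -> exists s : list I, forall i, v i x <> 0%N -> List.In i s) /\
    (forall x y, x <> 0 -> y <> 0 -> (forall i, (v i y <= v i x)%N) -> dvdR y x).

Definition ufd : Prop :=
  is_domain /\
  forall x : R, x <> 0 -> ~ unitR x ->
    (exists s : seq R, (forall p, List.In p s -> irreducible_elt p) /\
        x = \prod_(p <- s) p) /\
    (forall s t : seq R,
       (forall p, List.In p s -> irreducible_elt p) ->
       (forall p, List.In p t -> irreducible_elt p) ->
       \prod_(p <- s) p = x -> \prod_(p <- t) p = x ->
       exists t', perm_eq t t' /\ size s = size t' /\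
         forall i, (i < size s)%N -> assocR (nth 0 s i) (nth 0 t' i)).

End CommAlg.

(* Cl(R) ~= Cl(S): a homomorphism Div(R) -> Div(S) mapping principal divisors
   to principal divisors and inducing a bijection Div(R)/Prin(R) -> Div(S)/Prin(S).
   (Since Div(R) is free abelian, every isomorphism Cl(R) -> Cl(S) arises so.) *)
Definition cl_iso (R S : comPzRingType) : Prop :=
  exists phi : ((R -> Prop) -> int) -> ((S -> Prop) -> int),
    (forall D, divisor D -> divisor (phi D)) /\
    (forall D1 D2, divisor D1 -> divisor D2 ->
        phi (fun P => D1 P + D2 P) = (fun Q => phi D1 Q + phi D2 Q)) /\
    (forall D, divisor D -> principal_div D -> principal_div (phi D)) /\
    (forall D', divisor D' -> exists D, divisor D /\
        principal_div (fun Q => D' Q - phi D Q)) /\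
    (forall D, divisor D -> principal_div (phi D) -> principal_div D).

Definition PAB (A : comPzRingType) (a b p : A) : Prop :=
  prime_elt p /\ dvdR p a /\ ~ (exists x y, p * x + b * y = 1).

(* Main.v *)
(* A' embeds in the localization A[1/a] by X |-> b/a, and both rings have the same
   localization at a.  A prime factor p of a becomes a unit of A' when pA + bA = A;
   otherwise A'/pA' = (A/(p, b))[X] is a domain, so p stays prime.  Writing a = p^e a1
   with a1 outside (p, b), give p weight 1 and b weight e: if an element of A is
   divisible by p^m in A', reducing mod p shows inductively that it lies in the ideal
   spanned by the monomials p^i b^j of weight at least m, so hypothesis (iv) makes A'
   p-adically separated.  The valuations of A vanishing at a and the p-adic ones then
   define A' as a Krull domain.  Inverting primes does not change the class group
   (Nagata), so Cl(A) = Cl(A[1/a]) = Cl(A'), and a Krull domain is factorial if and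
   only if all its divisors are principal. *)
Require Import Defs.
From HB Require Import structures.
From Stdlib Require List.
From mathcomp Require Import all_boot all_order all_algebra.
From mathcomp Require Import boolp.
From mathcomp Require Import ring zify.
Import GRing.Theory.
Local Open Scope ring_scope.
Set Implicit Arguments.
Unset Strict Implicit.

(** The first half of the work bridges the two, showing that the height-one primes alone govern
    divisibility. They arise as colon ideals (y : xc): finiteness of the family replaces a
    Noetherian hypothesis, since a finite sum of valuation deficits can be minimised. No
    localization or fraction field is built. An element of A[1/a] is handled through an equation
    [f a ^+ d * z = f x], and a statement local at P carries a multiplier outside P. Dropping the
    valuations of A that are positive at a is harmless: a high power of a satisfies all their
    inequalities at once, and its prime factors are cancelled afterwards p-adically. Divisors of A
    and A' are compared directly and only away from a; over a, every height-one prime on either side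
    contains a prime element, so any discrepancy is principal. *)

Lemma argmin_nat (T : Type) (Q : T -> Prop) (f : T -> nat) :
  (exists c, Q c) -> exists c, Q c /\ forall c', Q c' -> (f c <= f c')%N.
Proof.
move=> [c0 Q0].
have [n] := ubnP (f c0).
elim: n c0 Q0 => // n IH c Qc ltn.
have [h|/existsNP [c' /not_implyP [Qc' /negP]]] :=
  pselect (forall c', Q c' -> (f c <= f c')%N); first by exists c.
by rewrite -ltnNge => h; apply: (IH c') => //; lia.
Qed.

Lemma leq_sum_In (I : Type) (l : seq I) (f g : I -> nat) :
  (forall i, (f i <= g i)%N) ->
  (\sum_(i <- l) g i <= \sum_(i <- l) f i)%N ->
  forall i, List.In i l -> f i = g i.
Proof.
move=> lefg; elim: l => //= j l IH; rewrite !big_cons => h.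
have := lefg j; have : (\sum_(i <- l) f i <= \sum_(i <- l) g i)%N.
  exact: leq_sum.
move=> h1 h2 i [<-|]; first lia.
by apply: IH; lia.
Qed.

(** * Divisibility, ideals and symbolic powers *)

Section Divisibility.
Variable R : comPzRingType.
Implicit Types (p x y z : R) (P Q : R -> Prop).

Lemma dvdR_refl x : dvdR x x. Proof. by exists 1; rewrite mulr1. Qed.

Lemma dvdR_trans x y z : dvdR x y -> dvdR y z -> dvdR x z.
Proof. by move=> [u ->] [w ->]; exists (u * w); rewrite mulrA. Qed.

Lemma dvdR0 x : dvdR x 0. Proof. by exists 0; rewrite mulr0. Qed.

Lemma dvdR_mulr x y z : dvdR x y -> dvdR x (y * z).
Proof. by move=> [u ->]; exists (u * z); rewrite mulrA. Qed.

Lemma dvdR_mull x y z : dvdR x y -> dvdR x (z * y).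
Proof. by rewrite mulrC; exact: dvdR_mulr. Qed.

Lemma dvdR_mul x y z t : dvdR x y -> dvdR z t -> dvdR (x * z) (y * t).
Proof. by move=> [u ->] [w ->]; exists (u * w); ring. Qed.

Lemma dvdRD x y z : dvdR x y -> dvdR x z -> dvdR x (y + z).
Proof. by move=> [u ->] [w ->]; exists (u + w); rewrite mulrDr. Qed.

Lemma mulr_neq0l x y : x * y <> 0 -> x <> 0.
Proof. by move=> h e; apply: h; rewrite e mul0r. Qed.

Lemma mulr_neq0r x y : x * y <> 0 -> y <> 0.
Proof. by rewrite mulrC; exact: mulr_neq0l. Qed.

Lemma prime_elt_ideal p : prime_elt p -> prime_ideal (dvdR p).
Proof.
move=> [_ [np pp]]; split; last by split.
split; first exact: dvdR0.
by split=> [x y|r x]; [exact: dvdRD|exact: dvdR_mull].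
Qed.

(** Serves as the induction principle for ideal powers; S is often an existential predicate, such as
    divisibility up to a multiplier. *)
Lemma ideal_mul_min P Q (S : R -> Prop) : S 0 ->
  (forall x y, S x -> S y -> S (x + y)) ->
  (forall x y, P x -> Q y -> S (x * y)) ->
  forall x, ideal_mul P Q x -> S x.
Proof.
move=> S0 SD SM x [ps [h ->]]; elim: ps h => [|q s IH] h; first by rewrite big_nil.
rewrite big_cons; apply: SD; last by apply: IH => k hk; apply: h; right.
by have [] := h q (or_introl erefl); exact: SM.
Qed.

Lemma ideal_mulM P Q x y : P x -> Q y -> ideal_mul P Q (x * y).
Proof.
move=> hx hy; exists [:: (x, y)]; split; last by rewrite big_seq1.
by move=> q [<-|].
Qed.

Lemma ideal_mul_ideal P Q : ideal P -> ideal (ideal_mul P Q).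
Proof.
move=> [_ [_ PM]]; split; first by exists [::]; split => //; rewrite big_nil.
split=> [_ _ [s [hs ->]] [t [ht ->]]|r _ [s [hs ->]]].
  exists (s ++ t); split; last by rewrite big_cat.
  by move=> q /List.in_app_iff [/hs|/ht].
exists (List.map (fun q => (r * q.1, q.2)) s); split.
  move=> _ /List.in_map_iff [q [<- /hs [h1 h2]]] /=.
  by split=> //; apply: PM.
elim: s {hs} => [|q s IH] /=; first by rewrite !big_nil mulr0.
by rewrite !big_cons mulrDr IH /= mulrA.
Qed.

Lemma ideal_pow_ideal P n : ideal P -> ideal (ideal_pow P n).
Proof. by case: n => [|n] hP; [do !split|exact: ideal_mul_ideal]. Qed.

Lemma ideal_powX P n x : P x -> ideal_pow P n (x ^+ n).
Proof. by move=> hx; elim: n => //= n IH; rewrite exprS; apply: ideal_mulM. Qed.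

Lemma ideal_powS P n x : ideal P -> ideal_pow P n.+1 x -> ideal_pow P n x.
Proof.
move=> iP; elim: n x => // n IH x.
have [h0 [hD _]] := ideal_pow_ideal n.+1 iP.
apply: (ideal_mul_min (P:=P) (Q:=ideal_pow P n.+1)) => // y z hy hz.
by apply: ideal_mulM => //; exact: IH.
Qed.

Lemma ideal_pow1 P x : ideal P -> ideal_pow P 1 x -> P x.
Proof.
move=> [P0 [PD PM]]; apply: ideal_mul_min => // y z hy _.
by rewrite mulrC; exact: PM.
Qed.

Lemma prime_ideal_exp P x n : prime_ideal P -> P (x ^+ n) -> P x.
Proof.
move=> [_ [P1 pP]]; elim: n => [/P1 //|n IH].
by rewrite exprS => /pP [].
Qed.

Lemma prime_ideal_prod P (s : seq R) :
  prime_ideal P -> P (\prod_(p <- s) p) -> exists p, List.In p s /\ P p.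
Proof.
move=> [_ [P1 pP]]; elim: s => [|p s IH]; first by rewrite big_nil => /P1.
rewrite big_cons => /pP [h|/IH [q [hq Pq]]]; first by exists p; split => //; left.
by exists q; split => //; right.
Qed.

Lemma symb_powS P n x : ideal P -> symb_pow P n.+1 x -> symb_pow P n x.
Proof. by move=> iP [s [Ps h]]; exists s; split => //; exact: ideal_powS. Qed.

Lemma symb_pow_leq P m n x : ideal P -> (m <= n)%N -> symb_pow P n x -> symb_pow P m x.
Proof.
move=> iP /subnK <-; elim: (n - m)%N => [//|k IH].
by rewrite addSn => /(symb_powS iP).
Qed.

Lemma ordP_uniq P x m n : ideal P -> ordP P x m -> ordP P x n -> m = n.
Proof.
move=> iP [h1 h2] [h3 h4].
case: (ltngtP m n) => // lt; exfalso.
  by apply: h2; apply: symb_pow_leq h3.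
by apply: h4; apply: symb_pow_leq h1.
Qed.

End Divisibility.

Section Domain.
Variable R : comPzRingType.
Hypothesis domR : is_domain R.
Implicit Types (p x y z : R) (P Q : R -> Prop).

Lemma dom_mulfI x y z : x <> 0 -> x * y = x * z -> y = z.
Proof.
move=> x0 /eqP; rewrite -subr_eq0 -mulrBr => /eqP /(proj2 domR) [//|/eqP].
by rewrite subr_eq0 => /eqP.
Qed.

Lemma dom_mulf_neq0 x y : x <> 0 -> y <> 0 -> x * y <> 0.
Proof. by move=> hx hy /(proj2 domR) []. Qed.

Lemma dom_neq10 : (1 : R) <> 0.
Proof. exact/eqP/(proj1 domR). Qed.

Lemma dom_expf_neq0 x n : x <> 0 -> x ^+ n <> 0.
Proof.
move=> hx; elim: n => [|n IH]; first exact: dom_neq10.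
by rewrite exprS; exact: dom_mulf_neq0.
Qed.

Lemma dom_dvd_mul2l x y z : x <> 0 -> dvdR (x * y) (x * z) -> dvdR y z.
Proof. by move=> x0 [t e]; exists t; apply: (dom_mulfI x0); rewrite e mulrA. Qed.

End Domain.

(** * Height-one primes of Krull domains *)

(** Says that r generates the maximal ideal of the localization R_P, with denominators cleared. *)
Definition uniformizer (R : comPzRingType) (P : R -> Prop) (r : R) : Prop :=
  [/\ r <> 0, P r & forall w, P w -> exists u, ~ P u /\ dvdR r (u * w)].

Section Valuations.
Variable R : comPzRingType.
Hypothesis domR : is_domain R.
Variables (I : Type) (v : I -> R -> nat).
Hypothesis vM : forall i x y, x <> 0 -> y <> 0 -> v i (x * y) = (v i x + v i y)%N.
Hypothesis vfin : forall x, x <> 0 ->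
  exists s : list I, forall i, v i x <> 0%N -> List.In i s.
Hypothesis vdvd : forall x y, x <> 0 -> y <> 0 ->
  (forall i, (v i y <= v i x)%N) -> dvdR y x.
Implicit Types (p x y z : R) (P Q T : R -> Prop).

Lemma val1 i : v i 1 = 0%N.
Proof. have := vM i (dom_neq10 domR) (dom_neq10 domR); rewrite mulr1; lia. Qed.

Lemma valX i x n : x <> 0 -> v i (x ^+ n) = (n * v i x)%N.
Proof.
move=> x0; elim: n => [|n IH]; first by rewrite val1.
by rewrite exprS vM //; [rewrite IH mulSn|exact: dom_expf_neq0].
Qed.

(** Divisibility in the localization at T is tested by the valuations trivial on T. Only finitely
    many other indices have [v i y] nonzero; for each, some t in T has [v i t] positive, and
    multiplying by [t ^+ v i y] repairs the inequality. *)
Lemma local_dvd T x y : T 1 -> (forall s t, T s -> T t -> T (s * t)) ->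
  ~ T 0 -> x <> 0 -> y <> 0 ->
  (forall i, (forall s, T s -> v i s = 0%N) -> (v i y <= v i x)%N) ->
  exists s, T s /\ dvdR y (s * x).
Proof.
move=> T1 TM T0 x0 y0 h.
have TX s n : T s -> T (s ^+ n).
  by move=> Ts; elim: n => // n IH; rewrite exprS; exact: TM.
have Tn s : T s -> s <> 0 by move=> Ts e; apply: T0; rewrite -e.
have [l hl] := vfin y0.
have [s [Ts hs]] : exists s, T s /\ forall i, List.In i l -> (v i y <= v i (s * x))%N.
  elim: l {hl} => [|i l [s [Ts hs]]]; first by exists 1.
  have [hi|/existsNP [t /not_implyP [Tt /eqP vt]]] :=
    pselect (forall s, T s -> v i s = 0%N).
    exists s; split => // j [<-|/hs //].
    by rewrite vM ?Tn //; [have := h _ hi; lia|exact: Tn].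
  have nX := dom_expf_neq0 domR (n:=v i y) (Tn _ Tt).
  have [ns nt] := (Tn _ Ts, Tn _ Tt).
  have nM := dom_mulf_neq0 domR ns nX.
  exists (s * t ^+ v i y); split; first by apply: TM => //; exact: TX.
  by move=> j [<-|/hs]; rewrite !vM // valX //; nia.
exists s; split => //; apply: vdvd => //; first by apply: dom_mulf_neq0 => //; exact: Tn.
move=> i; have [/hl/hs //|] := pselect (v i y <> 0%N).
by move=> /contrapT ->.
Qed.

Lemma local_dvdN T x y : T 1 -> (forall s t, T s -> T t -> T (s * t)) ->
  ~ T 0 -> x <> 0 -> y <> 0 -> (forall s, T s -> ~ dvdR y (s * x)) ->
  exists i, (forall s, T s -> v i s = 0%N) /\ (v i x < v i y)%N.
Proof.
move=> T1 TM T0 x0 y0 h; apply: contrapT => /forallNP hn.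
have [i hi|s [Ts /(h _ Ts)]] // := local_dvd T1 TM T0 x0 y0.
by rewrite leqNgt; apply/negP => lt; apply: (hn i).
Qed.

(* The prime is the T-saturated colon ideal of a multiple of x modulo y,
   chosen so that the positive parts of the v i y - v i x are minimal. *)
Lemma separating_prime T x y : T 1 -> (forall s t, T s -> T t -> T (s * t)) ->
  ~ T 0 -> x <> 0 -> y <> 0 -> (forall s, T s -> ~ dvdR y (s * x)) ->
  exists P r s u c, [/\ prime_ideal P, (forall t, T t -> ~ P t), uniformizer P r,
    T s & ~ P u /\ c <> 0 /\ y * u = s * r * (x * c)].
Proof.
move=> T1 TM T0 x0 y0 yNx.
have Tn s : T s -> s <> 0 by move=> Ts e; apply: T0; rewrite -e.
have [l hl] := vfin y0.
pose Q c := c <> 0 /\ forall s, T s -> ~ dvdR y (s * (x * c)).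
pose mu c := (\sum_(i <- l) (v i y - v i (x * c)%R))%N.
have [|c [[c0 Qc] minc]] := @argmin_nat R Q mu.
  by exists 1; split; [exact: dom_neq10|rewrite mulr1].
set x' := x * c.
have x'0 : x' <> 0 by exact: dom_mulf_neq0.
pose P w := exists s, T s /\ dvdR y (s * w * x').
have Py : P y by exists 1; split => //; exists x'; rewrite mul1r.
have P0 : P 0 by exists 1; split => //; rewrite mulr0 mul0r; exact: dvdR0.
have TP t : T t -> ~ P t.
  by move=> Tt [s [Ts]]; apply: Qc; exact: TM.
(* For r outside P, the multiple cr is still admissible, so minimality leaves every deficit
   unchanged: for each i, either [v i y] is already at most [v i x'] or [v i r] is 0. Hence r can be
   cancelled, which makes P prime. *)
have colonP r w : ~ P r -> dvdR y (w * (x' * r)) -> dvdR y (w * x').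
  move=> nPr yd.
  have r0 : r <> 0 by move=> e; apply: nPr; rewrite e.
  have Qcr : Q (c * r).
    split; first exact: dom_mulf_neq0.
    move=> s Ts hd; apply: nPr; exists s; split => //.
    by move: hd; rewrite (_ : s * (x * (c * r)) = s * r * x') // /x'; ring.
  have eqi i : (v i y - v i x' = v i y - v i (x' * r)%R)%N.
    have [il|] := pselect (List.In i l).
      apply/esym; apply: (@leq_sum_In _ l (fun i => (v i y - v i (x' * r)%R)%N)
        (fun i => (v i y - v i x')%N)) il.
      - by move=> j; rewrite vM //; lia.
      - by have := minc _ Qcr; rewrite /mu /x' mulrA.
    by move=> nl; have [->|/eqP/hl //] := eqVneq (v i y) 0%N.
  have [->|/eqP w0] := eqVneq w 0; first by rewrite mul0r; exact: dvdR0.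
  have xr0 := dom_mulf_neq0 domR x'0 r0.
  apply: vdvd => //; first exact: dom_mulf_neq0.
  move=> i; case: yd => t e.
  have t0 : t <> 0.
    by move=> t0; move: (dom_mulf_neq0 domR w0 xr0); rewrite e t0 mulr0.
  have := congr1 (v i) e; rewrite vM // (vM _ y0) // (vM _ w0) //.
  by have := eqi i; lia.
have pP : prime_ideal P.
  split; [split=> //; split|split].
  - move=> w1 w2 [s [Ts h1]] [t [Tt h2]]; exists (s * t); split; first exact: TM.
    rewrite (_ : _ * x' = t * (s * w1 * x') + s * (t * w2 * x')); last by ring.
    by apply: dvdRD; exact: dvdR_mull.
  - move=> r w [s [Ts h]]; exists s; split => //.
    rewrite (_ : s * (r * w) * x' = r * (s * w * x')); last by ring.
    exact: dvdR_mull.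
  - exact: TP.
  - move=> w1 w2 [s [Ts h]]; have [|nP1] := pselect (P w1); first by left.
    right; exists s; split => //; apply: colonP nP1 _.
    by rewrite (_ : _ * _ = s * (w1 * w2) * x') //; ring.
(* Take r of least v_i in P and write s r x' = y u. As v_i(x') < v_i(y), the value of u is below
   that of r, so u is outside P; this u is the multiplier that makes r a uniformizer. *)
have [i [iT lti]] := local_dvdN T1 TM T0 x'0 y0 Qc.
have [|r [[r0 Pr] minr]] := @argmin_nat R (fun w => w <> 0 /\ P w) (v i).
  by exists y.
have [s [Ts [u eu]]] := Pr.
have s0 := Tn _ Ts.
have sr0 := dom_mulf_neq0 domR s0 r0.
have u0 : u <> 0.
  by move=> u0; move: (dom_mulf_neq0 domR sr0 x'0); rewrite eu u0 mulr0.
have nPu : ~ P u.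
  move=> Pu; have := minr u (conj u0 Pu).
  by have := congr1 (v i) eu; have := lti; rewrite /x' !vM // (iT s) //; lia.
exists P, r, s, u, c; split => //.
split=> // w [s' [Ts' [w' e']]].
exists (s' * u); split.
  by move=> /(proj2 (proj2 pP)) [/(TP _ Ts')|].
exists (w' * s); apply: (dom_mulfI domR y0).
transitivity ((y * u) * (s' * w)); first by ring.
rewrite -eu; transitivity (s * r * (s' * w * x')); first by ring.
by rewrite e'; ring.
Qed.

(** Since r is not invertible at P, some v_i trivial outside P is positive on r. Dividing by r
    lowers that v_i, so the division stops. *)
Lemma uniformizer_val P r x : prime_ideal P -> uniformizer P r -> x <> 0 ->
  exists n s z, [/\ ~ P s, ~ P z & s * x = r ^+ n * z].
Proof.
move=> pP [r0 Pr hr] x0; have [iP [P1 PM]] := pP.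
have nPM s t : ~ P s -> ~ P t -> ~ P (s * t) by move=> h1 h2 /PM [].
have [|s Ps [t e]|i [iT]] :=
    local_dvdN (T := fun s => ~ P s) P1 nPM _ (dom_neq10 domR) r0.
- by move=> h; apply: h; exact: (proj1 iP).
- by apply: Ps; rewrite -(mulr1 s) e mulrC; apply: (proj2 (proj2 iP)).
rewrite val1 => lti.
have [n] := ubnP (v i x); elim: n x x0 => // n IH x x0 ltn.
have [Px|nPx] := pselect (P x); last by exists 0%N, 1, x; split=> //; rewrite expr0.
have [u [nPu [y e]]] := hr _ Px.
have u0 : u <> 0 by move=> u0; apply: nPu; rewrite u0; exact: (proj1 iP).
have y0 : y <> 0.
  by move=> y0; move: (dom_mulf_neq0 domR u0 x0); rewrite e y0 mulr0.
have [|m [s [z [nPs nPz e']]]] := IH y y0.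
  by have := congr1 (v i) e; rewrite !vM // iT //; lia.
exists m.+1, (s * u), z; split=> //; first exact: nPM.
by rewrite -mulrA e mulrCA e' exprS mulrA.
Qed.

Lemma separating_val P x : prime_ideal P -> P x -> x <> 0 ->
  exists i, (forall s, ~ P s -> v i s = 0%N) /\ (0 < v i x)%N.
Proof.
move=> [[P0 [_ Pm]] [P1 PM]] Px x0.
have [||s Ps [t e]|i [iT]] :=
    local_dvdN (T := fun s => ~ P s) P1 _ _ (dom_neq10 domR) x0.
- by move=> s t h1 h2 /PM [].
- by move=> h; apply: h.
- by apply: Ps; rewrite -(mulr1 s) e mulrC; apply: Pm.
by rewrite val1 => lti; exists i.
Qed.

End Valuations.

(** * Symbolic powers computed from a uniformizer *)

Section LocalOrder.
Variables (R : comPzRingType) (P : R -> Prop) (r : R).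
Hypothesis domR : is_domain R.
Hypothesis pP : prime_ideal P.
Hypothesis rP : uniformizer P r.

Let nPM s t : ~ P s -> ~ P t -> ~ P (s * t).
Proof. by move=> h1 h2 /(proj2 (proj2 pP)) []. Qed.

Lemma uniformizer_pow_dvd m x : ideal_pow P m x ->
  exists s, ~ P s /\ dvdR (r ^+ m) (s * x).
Proof.
have [_ Pr hr] := rP; have [iP [P1 PM]] := pP.
elim: m x => [|m IH] x.
  by move=> _; exists 1; split=> //; rewrite mul1r expr0; exists x; rewrite mul1r.
apply: (@ideal_mul_min R P (ideal_pow P m) (fun x => exists s, ~ P s /\ dvdR (r ^+ m.+1) (s * x))).
- by exists 1; split=> //; rewrite mulr0; exact: dvdR0.
- move=> y z [s [Ps hs]] [t [Pt ht]]; exists (s * t); split; first exact: nPM.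
  rewrite (_ : _ * _ = t * (s * y) + s * (t * z)); last by ring.
  by apply: dvdRD; exact: dvdR_mull.
- move=> y z /hr [u [Pu hu]] /IH [s [Ps hs]].
  exists (u * s); split; first exact: nPM.
  rewrite (_ : _ * (y * z) = (u * y) * (s * z)); last by ring.
  by rewrite exprS; exact: dvdR_mul.
Qed.

(** Identifies the symbolic order with the r-adic order in R_P: an extra factor r would force a
    product of elements outside P into P. *)
Lemma uniformizer_ordP n s z x : ~ P s -> ~ P z -> s * x = r ^+ n * z -> ordP P x n.
Proof.
have [r0 Pr hr] := rP; have [iP [P1 PM]] := pP => Ps Pz e.
split.
  exists s; split=> //; rewrite e mulrC.
  by apply: (proj2 (proj2 (ideal_pow_ideal n iP))); exact: ideal_powX.
move=> [t [Pt /uniformizer_pow_dvd [t' [Pt' [w ew]]]]].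
have : P (t' * t * z).
  rewrite (_ : t' * t * z = s * w * r); first by apply: (proj2 (proj2 iP)).
  apply: (dom_mulfI domR (dom_expf_neq0 domR (n:=n) r0)).
  transitivity (t' * t * (r ^+ n * z)); first by ring.
  rewrite -e; transitivity (s * (t' * (t * x))); first by ring.
  by rewrite ew exprS; ring.
by move=> /PM [/PM [/Pt'|/Pt]|/Pz].
Qed.

End LocalOrder.

(** * Height-one primes determine divisibility *)

Section KrullDomain.
Variable R : comPzRingType.
Hypothesis krullR : krull R.
Implicit Types (p x y z : R) (P Q T : R -> Prop).

Let domR : is_domain R := proj1 krullR.

(** A nonzero x in a prime Q inside P satisfies s x = r^n z with z outside P, so r lies in Q, and
    then so does all of P. *)
Lemma uniformizer_height_one P r : prime_ideal P -> uniformizer P r -> height_one P.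
Proof.
move=> pP rP; have [r0 Pr hr] := rP.
have [_ [I [v [vM [_ [_ [vfin vdvd]]]]]]] := krullR.
split=> //; split; first by exists r.
move=> Q [iQ [Q1 QM]] [x [Qx x0]] QP w Pw.
have [n [s [z [Ps Pz e]]]] := uniformizer_val domR vM vfin vdvd pP rP x0.
have Qr : Q r.
  have : Q (r ^+ n * z) by rewrite -e; apply: (proj2 (proj2 iQ)).
  by move=> /QM [/(prime_ideal_exp (conj iQ (conj Q1 QM)))|/QP].
have [u [Pu [t e']]] := hr _ Pw.
have : Q (u * w) by rewrite e' mulrC; apply: (proj2 (proj2 iQ)).
by move=> /QM [/QP|].
Qed.

(** With T the complement of P, the prime produced by [separating_prime] lies inside P; minimality
    of P makes them equal. *)
Lemma height_one_uniformizer P : height_one P -> exists r, uniformizer P r.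
Proof.
move=> [pP [[x [Px x0]] minP]]; have [iP [P1 PM]] := pP.
have [_ [I [v [vM [_ [_ [vfin vdvd]]]]]]] := krullR.
have [||s Ps [t e]|Q [r [s [u [c [pQ QT rQ _ _]]]]]] :=
  separating_prime domR vM vfin vdvd (T := fun s => ~ P s) P1 _ _ (dom_neq10 domR) x0.
- by move=> s t h1 h2 /PM [].
- by move=> h; apply: h; exact: (proj1 iP).
- by apply: Ps; rewrite -(mulr1 s) e mulrC; apply: (proj2 (proj2 iP)).
have QP w : Q w -> P w by move=> Qw; apply: contrapT => /QT.
have [r0 Qr _] := rQ.
have PQ := minP Q pQ (ex_intro _ r (conj Qr r0)) QP.
have <- : Q = P by apply: funext => w; apply: propext; split => [/QP|/PQ].
by exists r.
Qed.

Lemma ordP_factor P r x n : prime_ideal P -> uniformizer P r -> x <> 0 ->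
  ordP P x n -> exists s z, [/\ ~ P s, ~ P z & s * x = r ^+ n * z].
Proof.
move=> pP rP x0 hn.
have [_ [I [v [vM [_ [_ [vfin vdvd]]]]]]] := krullR.
have [m [s [z [Ps Pz e]]]] := uniformizer_val domR vM vfin vdvd pP rP x0.
have hm := uniformizer_ordP domR pP rP Ps Pz e.
by rewrite (ordP_uniq (proj1 pP) hn hm); exists s, z.
Qed.

Lemma ordP_exists P x : height_one P -> x <> 0 -> exists n, ordP P x n.
Proof.
move=> hP x0; have [r rP] := height_one_uniformizer hP.
have [_ [I [v [vM [_ [_ [vfin vdvd]]]]]]] := krullR.
have [m [s [z [Ps Pz e]]]] := uniformizer_val domR vM vfin vdvd (proj1 hP) rP x0.
by exists m; exact: (uniformizer_ordP domR (proj1 hP) rP Ps Pz e).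
Qed.

Lemma ordPM P x y m n : height_one P -> x <> 0 -> y <> 0 ->
  ordP P x m -> ordP P y n -> ordP P (x * y) (m + n).
Proof.
move=> hP x0 y0 hx hy; have [r rP] := height_one_uniformizer hP.
have pP := proj1 hP.
have [s [z [Ps Pz e]]] := ordP_factor pP rP x0 hx.
have [t [w [Pt Pw e']]] := ordP_factor pP rP y0 hy.
apply: (uniformizer_ordP domR pP rP (s := s * t) (z := z * w)).
- by move=> /(proj2 (proj2 pP)) [].
- by move=> /(proj2 (proj2 pP)) [].
- by rewrite mulrACA e e' exprD; ring.
Qed.

Lemma ordP_eq0 P x n : prime_ideal P -> ordP P x n -> (n == 0%N) = ~~ `[< P x >].
Proof.
move=> pP; have [iP [P1 PM]] := pP => hn; apply/eqP/negP.
  move=> n0; move: hn; rewrite n0 => -[_ h] /asboolP Px; apply: h.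
  exists 1; split=> //; rewrite mul1r -(mulr1 x).
  exact: ideal_mulM.
move=> /negP /asboolPn nPx; apply: (ordP_uniq iP hn); split.
  by exists 1.
move=> [s [Ps hs]]; by have /PM [/Ps|/nPx] := ideal_pow1 iP hs.
Qed.

Lemma separating_height_one x y : x <> 0 -> y <> 0 -> ~ dvdR y x ->
  exists P m n, [/\ height_one P, ordP P x m, ordP P y n & (m < n)%N].
Proof.
move=> x0 y0 nd.
have [_ [I [v [vM [_ [_ [vfin vdvd]]]]]]] := krullR.
have [|||P [r [s [u [c [pP PT rP s1 [Pu [c0 e]]]]]]]] :=
  separating_prime domR vM vfin vdvd (T := fun s => s = 1) (x := x) erefl _ _ x0 y0.
- by move=> s t -> ->; rewrite mulr1.
- by move=> e; apply: (dom_neq10 domR).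
- by move=> s ->; rewrite mul1r.
have hP := uniformizer_height_one pP rP.
have [r0 Pr _] := rP.
have [m hm] := ordP_exists hP x0.
have [n hn] := ordP_exists hP y0.
have [k hk] := ordP_exists hP c0.
have [d hd] := ordP_exists hP r0.
have u0 : u <> 0 by move=> u0; apply: Pu; rewrite u0; case: (proj1 pP).
have [j hj] := ordP_exists hP u0.
exists P, m, n; split=> //.
(* Orders in y u = r x c: u contributes 0 and r at least 1, so y has strictly larger order than
   x. *)
have := ordPM hP y0 u0 hn hj; rewrite e s1 mul1r => h1.
have := ordPM hP r0 (dom_mulf_neq0 domR x0 c0) hd (ordPM hP x0 c0 hm hk).
move=> /(ordP_uniq (proj1 pP) h1).
have /eqP -> : j == 0%N by rewrite (ordP_eq0 pP hj); apply/negP => /asboolP.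
have : d != 0%N by rewrite (ordP_eq0 pP hd) negbK; apply/asboolP.
by lia.
Qed.

Lemma ordP_dvd x y : x <> 0 -> y <> 0 ->
  (forall P m n, height_one P -> ordP P x m -> ordP P y n -> (n <= m)%N) ->
  dvdR y x.
Proof.
move=> x0 y0 h; apply: contrapT => /(separating_height_one x0 y0).
by move=> [P [m [n [hP hm hn]]]]; rewrite ltnNge (h P m n).
Qed.

Lemma height_one_finite x : x <> 0 ->
  exists s : list (R -> Prop), forall P, height_one P -> P x -> List.In P s.
Proof.
move=> x0; have [_ [I [v [vM [_ [_ [vfin vdvd]]]]]]] := krullR.
have [l hl] := vfin _ x0.
(* The list consists of the centers of the finitely many valuations nonzero on x. A height-one P
   containing x is one of them: some v_i trivial outside P is positive on x, hence on the
   uniformizer, hence on all of P except 0. *)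
exists (List.map (fun i w => w = 0 \/ (0 < v i w)%N) l) => P hP Px.
have pP := proj1 hP; have [iP [P1 PM]] := pP.
have [i [iP0 lti]] := separating_val domR vM vfin vdvd pP Px x0.
apply/List.in_map_iff; exists i; split; last by apply: hl; lia.
have P0 : P 0 by case: iP.
have nP0 s : ~ P s -> s <> 0 by move=> h e; apply: h; rewrite e.
have [r rP] := height_one_uniformizer hP; have [r0 Pr hr] := rP.
have ltr : (0 < v i r)%N.
  have [n hn] := ordP_exists hP x0.
  have [s [z [Ps Pz e]]] := ordP_factor pP rP x0 hn.
  have := congr1 (v i) e.
  have h1 := dom_expf_neq0 domR (n:=n) r0.
  rewrite !vM //; try exact: nP0.
  by rewrite (iP0 s) // (iP0 z) // (valX domR vM) //; nia.
apply: funext => w; apply: propext; split.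
  by move=> [->//|ltw]; apply: contrapT => /iP0; lia.
move=> Pw; have [->|/eqP w0] := eqVneq w 0; [by left|right].
have [u [Pu [t e]]] := hr _ Pw.
have u0 := nP0 _ Pu.
have t0 : t <> 0.
  by move=> t0; move: (dom_mulf_neq0 domR u0 w0); rewrite e t0 mulr0.
by have := congr1 (v i) e; rewrite !vM // iP0 //; lia.
Qed.

End KrullDomain.

Lemma In_mem (T : eqType) (s : seq T) x : List.In x s <-> x \in s.
Proof.
elim: s => //= y s IH; rewrite inE; split.
  by move=> [->|/IH ->]; rewrite ?eqxx ?orbT.
by move=> /orP [/eqP ->|/IH]; [left|right].
Qed.

(** * Divisors and factoriality *)

Section DivisorOfElement.
Variable R : comPzRingType.
Implicit Types (x y p : R) (P Q : R -> Prop) (D : (R -> Prop) -> int).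

Definition divf x P : int :=
  if pselect (exists n, height_one P /\ ordP P x n) is left h
  then (sval (cid h))%:Z else 0.

Lemma divf_ordP x P n : height_one P -> ordP P x n -> divf x P = n%:Z.
Proof.
move=> hP hn; rewrite /divf; case: pselect => [h|[]]; last by exists n.
case: cid => m /= [_ hm].
by rewrite (ordP_uniq (proj1 (proj1 hP)) hm hn).
Qed.

Lemma divf_notin x P : ~ height_one P -> divf x P = 0.
Proof. by move=> nP; rewrite /divf; case: pselect => // -[n []]. Qed.

Lemma div_of_divf x D : div_of x D -> D = divf x.
Proof.
move=> [h0 h1]; apply: funext => P.
have [hP|nP] := pselect (height_one P); last by rewrite h0 // divf_notin.
by have [n [hn ->]] := h1 _ hP; rewrite (divf_ordP hP hn).
Qed.

Lemma divisorB D1 D2 : divisor D1 -> divisor D2 -> divisor (fun P => D1 P - D2 P).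
Proof.
move=> [h1 [s1 hs1]] [h2 [s2 hs2]]; split=> [P nP|].
  by rewrite h1 // h2 // subrr.
exists (s1 ++ s2) => P hP; apply/List.in_app_iff.
have [e|/eqP/hs1] := eqVneq (D1 P) 0; last by left.
by right; apply: hs2 => e2; apply: hP; rewrite e e2 subrr.
Qed.

Hypothesis krullR : krull R.
Let domR : is_domain R := proj1 krullR.

Lemma divf_div_of x : x <> 0 -> div_of x (divf x).
Proof.
move=> x0; split=> [P|P hP]; first exact: divf_notin.
by have [n hn] := ordP_exists krullR hP x0; exists n; rewrite (divf_ordP hP hn).
Qed.

Lemma principal_divP D : principal_div D <->
  exists x y, [/\ x <> 0, y <> 0 & forall P, D P = divf x P - divf y P].
Proof.
split=> [[x [y [Dx [Dy [x0 [y0 [hx [hy h]]]]]]]]|[x [y [x0 y0 h]]]].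
  by exists x, y; split=> // P; rewrite h (div_of_divf hx) (div_of_divf hy).
exists x, y, (divf x), (divf y).
exact: (conj x0 (conj y0 (conj (divf_div_of x0) (conj (divf_div_of y0) h)))).
Qed.

Lemma divfM x y P : x <> 0 -> y <> 0 -> divf (x * y) P = divf x P + divf y P.
Proof.
move=> x0 y0.
have [hP|nP] := pselect (height_one P); last by rewrite !divf_notin.
have [m hm] := ordP_exists krullR hP x0.
have [n hn] := ordP_exists krullR hP y0.
rewrite (divf_ordP hP hm) (divf_ordP hP hn).
by rewrite (divf_ordP hP (ordPM krullR hP x0 y0 hm hn)) PoszD.
Qed.

Lemma divf_eq0 x P : height_one P -> x <> 0 -> divf x P = 0 <-> ~ P x.
Proof.
move=> hP x0; have [n hn] := ordP_exists krullR hP x0.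
rewrite (divf_ordP hP hn); have := ordP_eq0 (proj1 hP) hn.
split.
  by move=> [n0]; move: H; rewrite n0 => /esym/negP h Px; apply: h; apply/asboolP.
by move=> nPx; move: H; rewrite asboolF // => /eqP ->.
Qed.

Lemma divf1 P : divf 1 P = 0.
Proof.
have [hP|nP] := pselect (height_one P); last exact: divf_notin.
by apply/(divf_eq0 hP (dom_neq10 domR)); case: (proj1 hP) => _ [].
Qed.

Lemma divfX x n P : x <> 0 -> divf (x ^+ n) P = n%:Z * divf x P.
Proof.
move=> x0; elim: n => [|n IH]; first by rewrite divf1 mul0r.
rewrite exprS divfM //; last exact: dom_expf_neq0.
by rewrite IH -addn1 PoszD; ring.
Qed.

Lemma divisor_divf x : x <> 0 -> divisor (divf x).
Proof.
move=> x0; split; first exact: divf_notin.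
have [s hs] := height_one_finite krullR x0; exists s => P hP.
have [h1|/divf_notin /hP //] := pselect (height_one P).
by apply: hs => //; apply: contrapT => /(divf_eq0 h1 x0).
Qed.

Lemma divf_dvd x y : x <> 0 -> y <> 0 -> (forall P, divf y P <= divf x P) -> dvdR y x.
Proof.
move=> x0 y0 h; apply: (ordP_dvd krullR) => // P m n hP hm hn.
by have := h P; rewrite (divf_ordP hP hm) (divf_ordP hP hn); lia.
Qed.

Lemma divf_ge0 x P : 0 <= divf x P.
Proof. by rewrite /divf; case: pselect. Qed.

Lemma principal_div_add D1 D2 D : principal_div D1 -> principal_div D2 ->
  (forall P, D P = D1 P + D2 P) -> principal_div D.
Proof.
move=> /principal_divP [x1 [y1 [hx1 hy1 h1]]] /principal_divP [x2 [y2 [hx2 hy2 h2]]] h.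
apply/principal_divP; exists (x1 * x2), (y1 * y2).
split; [exact: dom_mulf_neq0|exact: dom_mulf_neq0|].
by move=> P; rewrite h h1 h2 !divfM //; ring.
Qed.

Lemma height_one_prime_elt P p : height_one P -> prime_elt p -> P p -> P = dvdR p.
Proof.
move=> [[[P0 [_ PM]] _] [_ minP]] pp Pp.
have pP w : dvdR p w -> P w by move=> [z ->]; rewrite mulrC; apply: PM.
have Pd := minP (dvdR p) (prime_elt_ideal pp) _ pP.
apply: funext => w; apply: propext; split; last exact: pP.
by apply: Pd; exists p; split; [exact: dvdR_refl|case: pp].
Qed.

Lemma divf_prime p : prime_elt p -> height_one (dvdR p) -> divf p (dvdR p) = 1.
Proof.
move=> pp hp; have [p0 [np _]] := pp.
have p1 : ~ dvdR p 1 by [].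
apply: (divf_ordP hp); apply: (@uniformizer_ordP _ _ p domR _ _ 1%N 1 1) => //.
- exact: prime_elt_ideal.
- split=> //; first exact: dvdR_refl.
  by move=> w pw; exists 1; rewrite mul1r.
- by rewrite mul1r mulr1.
Qed.

(** A height-one prime P containing a prime element p equals pR, and div p is 1 at P and 0
    elsewhere. Subtracting D(P) div p removes P from the support, and the list bounding the support
    shrinks. *)
Lemma principal_div_of_primes D : divisor D ->
  (forall P, D P <> 0 -> exists p, prime_elt p /\ P p) -> principal_div D.
Proof.
move=> [hD [l hl]]; elim: l D hD hl => [|P l IH] D hD hl hp.
  apply/principal_divP; exists 1, 1; split; try exact: dom_neq10.
  by move=> P; rewrite subrr; apply: contrapT => /hl.
have [D0|/eqP D0] := eqVneq (D P) 0.
  by apply: IH => // Q hQ; case: (hl _ hQ) => // e; move: hQ; rewrite -e.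
have hP : height_one P by apply: contrapT => /hD.
have [p [pp Pp]] := hp _ D0; have [p0 _] := pp.
have eP := height_one_prime_elt hP pp Pp.
have vP : divf p P = 1 by rewrite eP divf_prime // -eP.
have vQ Q : Q <> P -> divf p Q = 0.
  move=> QP; have [hQ|nQ] := pselect (height_one Q); last exact: divf_notin.
  by apply/(divf_eq0 hQ p0) => /(height_one_prime_elt hQ pp); rewrite -eP.
pose D' Q := D Q - D P * divf p Q.
have D'Q Q : Q <> P -> D' Q = D Q by move=> h; rewrite /D' vQ // mulr0 subr0.
have D'P : D' P = 0 by rewrite /D' vP mulr1 subrr.
apply: (@principal_div_add D' (fun Q => D P * divf p Q)).
- apply: IH => [Q nQ|Q|Q].
  + by rewrite /D' hD // divf_notin // mulr0 subr0.
  + have [->//|QP] := pselect (Q = P); rewrite D'Q // => /hl [e|//].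
    by case: QP.
  + by have [->//|QP] := pselect (Q = P); rewrite D'Q // => /hp.
(* A negative coefficient [Negz n] stands for -(n+1), so p^(n+1) goes into the denominator. *)
- apply/principal_divP; case: (D P) => n.
    exists (p ^+ n), 1; split; [exact: dom_expf_neq0|exact: dom_neq10|].
    by move=> Q; rewrite divfX // divf1 subr0.
  exists 1, (p ^+ n.+1); split; [exact: dom_neq10|exact: dom_expf_neq0|].
  by move=> Q; rewrite divfX // divf1 NegzE; ring.
- by move=> Q; rewrite /D'; ring.
Qed.

(** The total valuation over a list supporting x is additive on factorizations and positive on
    nonunit factors, because an element with all valuations zero divides 1. *)
Lemma krull_prod_irreducible x : x <> 0 -> ~ unitR x ->
  exists s : seq R, (forall p, List.In p s -> irreducible_elt p) /\ x = \prod_(p <- s) p.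
Proof.
have [_ [I [v [vM [_ [_ [vfin vdvd]]]]]]] := krullR.
move=> x0; have [l hl] := vfin _ x0.
have [n] := ubnP (\sum_(i <- l) v i x)%N.
elim: n x x0 hl => // n IH x x0 hl ltn nx.
have [irr|] := pselect (irreducible_elt x).
  by exists [:: x]; rewrite big_seq1; split=> // p [<-|].
move=> /not_andP [//|/not_andP [//|/existsNP [y /existsNP [z /not_implyP [e]]]]].
move=> /not_orP [ny nz].
have y0 : y <> 0 by apply: (@mulr_neq0l _ _ z); rewrite -e.
have z0 : z <> 0 by apply: (@mulr_neq0r _ y); rewrite -e.
have vx i : v i x = (v i y + v i z)%N by rewrite e vM.
have lt w : w <> 0 -> (forall i, (v i w <= v i x)%N) -> ~ unitR w ->
    (0 < \sum_(i <- l) v i w)%N.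
  move=> w0 wx nw; rewrite lt0n; apply/negP => /eqP s0; apply: nw.
  apply: vdvd => //; first exact: dom_neq10.
  move=> i; have [il|nil] := pselect (List.In i l); last first.
    have : v i x = 0%N by apply: contrapT => /hl.
    by have := wx i; lia.
  rewrite (_ : v i w = 0%N) //; symmetry.
  by apply: (@leq_sum_In _ l (fun=> 0%N) (fun i => v i w)) il => //; rewrite s0.
have Ex : (\sum_(i <- l) v i x = \sum_(i <- l) v i y + \sum_(i <- l) v i z)%N.
  by rewrite -big_split; apply: eq_bigr => i _; rewrite vx.
have ly : (0 < \sum_(i <- l) v i y)%N by apply: lt => // i; rewrite vx; lia.
have lz : (0 < \sum_(i <- l) v i z)%N by apply: lt => // i; rewrite vx; lia.
have [||s [hs es]] := IH y y0 _ _ ny; [by move=> i h; apply: hl; rewrite vx; lia|lia|].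
have [||t [ht et]] := IH z z0 _ _ nz; [by move=> i h; apply: hl; rewrite vx; lia|lia|].
exists (s ++ t); rewrite big_cat -es -et; split=> // p /List.in_app_iff [/hs|/ht] //.
Qed.

End DivisorOfElement.

(** * Unique factorization through principal divisors *)

Section Factoriality.
Variable R : comPzRingType.
Implicit Types (x y z p q : R) (P Q : R -> Prop) (D : (R -> Prop) -> int).

(** The products are only assumed associate because cancelling a prime against an associated
    irreducible leaves a unit behind. *)
Lemma prime_factorization_uniq (s t : seq R) : is_domain R ->
  (forall p, List.In p s -> prime_elt p) ->
  (forall p, List.In p t -> irreducible_elt p) ->
  assocR (\prod_(p <- s) p) (\prod_(p <- t) p) ->
  exists t', perm_eq t t' /\ size s = size t' /\
         forall i, (i < size s)%N -> assocR (nth 0 s i) (nth 0 t' i).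
Proof.
move=> domR; elim: s t => [|p s IH] t hs ht.
  rewrite big_nil => -[_ ut]; exists [::]; split=> //.
  case: t ht ut => // q t ht; rewrite big_cons => ut; exfalso.
  have [_ [nq _]] := ht q (or_introl erefl); apply: nq.
  by apply: dvdR_trans ut; exact: dvdR_mulr (dvdR_refl _).
rewrite big_cons => -[st ts].
have pp : prime_elt p by apply: hs; left.
have [p0 [np _]] := pp.
have /(prime_ideal_prod (prime_elt_ideal pp)) [q [qt [w e]]] : dvdR p (\prod_(q <- t) q).
  by apply: dvdR_trans st; exact: dvdR_mulr (dvdR_refl _).
have [//|w1] := proj2 (proj2 (ht _ qt)) _ _ e.
have [w' ew] := w1.
have tq : q \in t by apply/In_mem.
have et := perm_to_rem tq.
have Et : \prod_(q <- t) q = p * (w * \prod_(q <- rem q t) q).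
  by rewrite (perm_big _ et) big_cons mulrA -e.
rewrite Et in st ts; move: st ts =>/(dom_dvd_mul2l domR p0) st /(dom_dvd_mul2l domR p0) ts.
have [|r||t' [h1 [h2 h3]]] := IH (rem q t).
- by move=> r hr; apply: hs; right.
- by move=> /In_mem/mem_rem/In_mem; exact: ht.
- split; last by apply: dvdR_trans ts; exact: dvdR_mull (dvdR_refl _).
  apply: dvdR_trans st _; exists w'.
  by rewrite mulrAC -ew mul1r.
exists (q :: t'); split; first by rewrite (perm_trans et) // perm_cons.
split; first by rewrite /= h2.
case=> [_|i] /=; last exact: h3.
split; first by exists w.
by exists w'; rewrite e -mulrA -ew mulr1.
Qed.

Lemma krull_ufd : krull R -> (forall x, irreducible_elt x -> prime_elt x) -> ufd R.
Proof.
move=> kR irrP; have domR := proj1 kR; split=> // x x0 nx.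
split; first exact: krull_prod_irreducible.
move=> s t hs ht es et; apply: prime_factorization_uniq => //.
  by move=> p /hs/irrP.
by rewrite es et; split; exact: dvdR_refl.
Qed.

(** In x w = y z, the factorization of the left side containing x is matched with one made from
    factors of y and z, so x is associate to one of these. Units among y, z, w are treated apart, as
    [ufd] factors nonunits only. *)
Lemma ufd_irreducible_prime x : ufd R -> irreducible_elt x -> prime_elt x.
Proof.
move=> [domR hR] irr; have [x0 [nx hx]] := irr; split=> //; split=> // y z [w e].
have [->|/eqP y0] := eqVneq y 0; first by left; exact: dvdR0.
have [->|/eqP z0] := eqVneq z 0; first by right; exact: dvdR0.
have [uy|ny] := pselect (unitR y).
  right; have [y' ey] := uy; exists (w * y').
  by rewrite mulrA -e mulrAC -ey mul1r.
have [uz|nz] := pselect (unitR z).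
  left; have [z' ez] := uz; exists (w * z').
  by rewrite mulrA -e -mulrA -ez mulr1.
have yz0 := dom_mulf_neq0 domR y0 z0.
have w0 : w <> 0 by apply: (@mulr_neq0r _ x); rewrite -e.
have [uw|nw] := pselect (unitR w).
  have [w' ew] := uw.
  have : x = y * (z * w') by rewrite mulrA e -mulrA -ew mulr1.
  move=> /hx [//|[t et]]; exfalso; apply: nz.
  by exists (w' * t); rewrite mulrA.
have nyz : ~ unitR (y * z).
  by move=> [t et]; apply: ny; exists (z * t); rewrite mulrA.
have [[s [hs es]] _] := hR _ y0 ny.
have [[t [ht et]] _] := hR _ z0 nz.
have [[r [hr er]] _] := hR _ w0 nw.
have [_ uniq] := hR _ yz0 nyz.
have [|||| t' [h1 [h2 h3]]] := uniq (x :: r) (s ++ t).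
- by move=> p [<-|/hr].
- by move=> p /List.in_app_iff [/hs|/ht].
- by rewrite big_cons -er -e.
- by rewrite big_cat -es -et.
have [xt _] := h3 0%N erefl.
have : nth 0 t' 0 \in s ++ t by rewrite (perm_mem h1) mem_nth // -h2.
have dvd_prod (u : seq R) q : q \in u -> dvdR q (\prod_(p <- u) p).
  by move=> /perm_to_rem/(perm_big _) ->; rewrite big_cons; exists (\prod_(p <- rem q u) p).
rewrite mem_cat => /orP [/dvd_prod|/dvd_prod]; rewrite -?es -?et => h; [left|right].
  exact: dvdR_trans xt h.
exact: dvdR_trans xt h.
Qed.

Lemma ufd_principal_div D : krull R -> ufd R -> divisor D -> principal_div D.
Proof.
move=> kR uR hD; apply: (principal_div_of_primes kR) => // P DP.
have [pP [[x [Px x0]] _]] : height_one P by apply: contrapT => /(proj1 hD).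
have nx : ~ unitR x.
  move=> [y e]; have [[_ [_ PM]] [P1 _]] := pP.
  by apply: P1; rewrite e mulrC; apply: PM.
have [[s [hs es]] _] := proj2 uR _ x0 nx.
have [|p [ps Pp]] := @prime_ideal_prod _ P s pP; first by rewrite -es.
by exists p; split=> //; apply: (ufd_irreducible_prime uR); exact: hs.
Qed.

(** An irreducible x lies in some height-one P. The divisor with value 1 at P alone is div t, so t
    generates P; x = t w then makes w a unit, and x generates P too. *)
Lemma principal_div_ufd : krull R ->
  (forall D, divisor D -> principal_div D) -> ufd R.
Proof.
move=> kR hD; have domR := proj1 kR.
apply: krull_ufd => // x irr; have [x0 [nx hx]] := irr.
have [P [m [n [hP hm hn lt]]]] := separating_height_one kR (dom_neq10 domR) x0 nx.
have Px : P x.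
  apply: contrapT => nPx; have := ordP_eq0 (proj1 hP) hn.
  by rewrite asboolF //; lia.
have [[P0 [_ Pm]] [P1 PM]] := proj1 hP.
have [|y0 [y1 [hy0 hy1 hy]]] := (principal_divP kR _).1 (hD (fun Q => (`[< Q = P >] : nat)%:Z) _).
  split=> [Q nQ|]; first by rewrite asboolF // => e; apply: nQ; rewrite e.
  exists [:: P] => Q; case: asboolP => //= ->; by left.
(* The divisor of y0/y1 is effective, so the fraction is an element t of R. *)
have [|t e] := divf_dvd kR hy0 hy1.
  by move=> Q; have := hy Q; case: asboolP => /=; lia.
have t0 : t <> 0 by apply: (@mulr_neq0r _ y1); rewrite -e.
have dt Q : divf t Q = (`[< Q = P >] : nat)%:Z.
  by rewrite hy e (divfM kR Q hy1 t0) addrAC subrr add0r.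
have tP z : P z -> dvdR t z.
  move=> Pz; have [->|/eqP z0] := eqVneq z 0; first exact: dvdR0.
  apply: (divf_dvd kR) => // Q; rewrite dt; case: asboolP => [->|_] /=; last exact: divf_ge0.
  have := divf_ge0 z P; have : divf z P <> 0 by move=> /(divf_eq0 kR hP z0).
  by lia.
have Pt : P t.
  by apply: contrapT => /(divf_eq0 kR hP t0); rewrite dt asboolT.
have Ptd z : dvdR t z -> P z by move=> [w ->]; rewrite mulrC; apply: Pm.
have [w ex] := tP _ Px.
have [/Ptd //|[w' ew]] := hx _ _ ex.
have xP z : P z -> dvdR x z.
  move=> /tP [u ->]; exists (w' * u).
  by rewrite ex -{1}(mulr1 t) ew; ring.
split=> //; split=> // y z [u eyz].
have : P (y * z) by rewrite eyz mulrC; apply: Pm.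
by move=> /PM [/xP|/xP]; [left|right].
Qed.

End Factoriality.

(** * Class groups and localization *)

(* R and S share the localization R[1/a] = S[1/f a]; height-one primes avoiding a
   correspond, and those containing a are principal. *)
Section NagataClassGroup.
Variables (R S : comPzRingType) (f : {rmorphism R -> S}) (a : R).
Hypotheses (krullR : krull R) (krullS : krull S).
Hypothesis f_eq0 : forall x, f x = 0 -> x = 0.
Hypothesis f_frac : forall z, exists d x, f a ^+ d * z = f x.
Implicit Types (x y : R) (z w : S) (P : R -> Prop) (Q : S -> Prop).

Let domR : is_domain R := proj1 krullR.
Let domS : is_domain S := proj1 krullS.

Definition contraction Q x : Prop := Q (f x).
(** This is the trace on S of P R[1/a], in general larger than the ideal generated by the image of
    P. *)
Definition extension P z : Prop := exists d x, P x /\ f a ^+ d * z = f x.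

Lemma rmorph_inj x y : f x = f y -> x = y.
Proof.
move=> e; apply/eqP; rewrite -subr_eq0; apply/eqP/f_eq0.
by rewrite rmorphB e subrr.
Qed.

Lemma contraction_prime Q : prime_ideal Q -> prime_ideal (contraction Q).
Proof.
move=> [[Q0 [QD QM]] [Q1 pQ]]; rewrite /contraction; split; [split; [|split]|split].
- by rewrite rmorph0.
- by move=> x y; rewrite rmorphD; exact: QD.
- by move=> x y; rewrite rmorphM; exact: QM.
- by rewrite rmorph1.
- by move=> x y; rewrite rmorphM; exact: pQ.
Qed.

Lemma extensionP P x : prime_ideal P -> ~ P a -> extension P (f x) <-> P x.
Proof.
move=> pP nPa; split; last by move=> Px; exists 0%N, x; rewrite mul1r.
move=> [d [y [Py]]]; rewrite -rmorphXn -rmorphM => /rmorph_inj e.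
have : P (a ^+ d * x) by rewrite e.
by move=> /(proj2 (proj2 pP)) [/(prime_ideal_exp pP)|].
Qed.

Lemma extension_prime P : prime_ideal P -> ~ P a -> prime_ideal (extension P).
Proof.
move=> pP nPa; have [[P0 [PD PM]] [P1 _]] := pP; split; [split; [|split]|split].
- by exists 0%N, 0; rewrite mulr0 rmorph0.
- move=> z w [d [x [Px ex]]] [e [y [Py ey]]]; exists (d + e)%N, (a ^+ e * x + a ^+ d * y).
  split; first by apply: PD; exact: PM.
  by rewrite rmorphD !rmorphM !rmorphXn -ex -ey exprD; ring.
- move=> w z [d [x [Px ex]]]; have [e [y ey]] := f_frac w.
  exists (d + e)%N, (y * x); split; first exact: PM.
  by rewrite rmorphM -ex -ey exprD; ring.
- by rewrite -(rmorph1 f) => /(extensionP _ pP nPa).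
- move=> z w [d [x [Px ex]]].
  have [e [y ey]] := f_frac z; have [k [t et]] := f_frac w.
  have : P (a ^+ d * (y * t)).
    rewrite (_ : _ * _ = a ^+ e * a ^+ k * x); first exact: PM.
    by apply: rmorph_inj; rewrite !rmorphM !rmorphXn -ex -ey -et; ring.
  move=> /(proj2 (proj2 pP)) [/(prime_ideal_exp pP) //|].
  move=> /(proj2 (proj2 pP)) [Py|Pt]; [left; by exists e, y|right; by exists k, t].
Qed.

Lemma extensionK P : prime_ideal P -> ~ P a -> contraction (extension P) = P.
Proof.
by move=> pP nPa; apply: funext => x; apply: propext; exact: extensionP.
Qed.

Lemma contractionK Q : prime_ideal Q -> ~ Q (f a) -> extension (contraction Q) = Q.
Proof.
move=> pQ nQa; have [[_ [_ QM]] [_ QP]] := pQ.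
apply: funext => z; apply: propext; split.
  move=> [d [x [Qx e]]]; have : Q (f a ^+ d * z) by rewrite e.
  by move=> /QP [/(prime_ideal_exp pQ)|].
move=> Qz; have [d [x e]] := f_frac z; exists d, x; split=> //.
by rewrite /contraction -e; exact: QM.
Qed.

Lemma extension_height_one P : height_one P -> ~ P a -> height_one (extension P).
Proof.
move=> [pP [[x [Px x0]] minP]] nPa.
have pE := extension_prime pP nPa; split=> //; split.
  exists (f x); split; first exact/extensionP.
  by move=> /f_eq0.
move=> Q pQ [z [Qz z0]] QE w [d [y [Py e]]].
have nQa : ~ Q (f a) by move=> /QE /(extensionP _ pP nPa).
have [k [t et]] := f_frac z.
have fa0 : f a <> 0 by move=> e0; apply: nQa; rewrite e0; case: pQ => -[].
have Qy : contraction Q y.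
  apply: (minP _ (contraction_prime pQ)) Py.
    exists t; split; first by rewrite /contraction -et; apply: (proj2 (proj2 (proj1 pQ))).
    move=> t0; move: (dom_mulf_neq0 domS (dom_expf_neq0 domS (n:=k) fa0) z0).
    by rewrite et t0 rmorph0.
  by move=> u /QE /(extensionP _ pP nPa).
by rewrite -(contractionK pQ nQa); exists d, y.
Qed.

Lemma contraction_height_one Q : height_one Q -> ~ Q (f a) -> height_one (contraction Q).
Proof.
move=> [pQ [[z [Qz z0]] minQ]] nQa.
have fa0 : f a <> 0 by move=> e0; apply: nQa; rewrite e0; case: pQ => -[].
have pC := contraction_prime pQ; split=> //; split.
  have [k [t et]] := f_frac z.
  exists t; split; first by rewrite /contraction -et; apply: (proj2 (proj2 (proj1 pQ))).
  move=> t0; move: (dom_mulf_neq0 domS (dom_expf_neq0 domS (n:=k) fa0) z0).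
  by rewrite et t0 rmorph0.
move=> P pP [x [Px x0]] PC y Qy.
have nPa : ~ P a by move=> /PC.
apply/(extensionP _ pP nPa); apply: minQ Qy; first exact: extension_prime.
  by exists (f x); split; [exact/extensionP|move=> /f_eq0].
move=> w [d [u [/PC Qu e]]]; have : Q (f a ^+ d * w) by rewrite e.
by move=> /(proj2 (proj2 pQ)) [/(prime_ideal_exp pQ)|].
Qed.

Lemma ideal_pow_contraction Q n z : prime_ideal Q -> ideal_pow Q n z ->
  exists d x, f a ^+ d * z = f x /\ ideal_pow (contraction Q) n x.
Proof.
move=> pQ; have iC := proj1 (contraction_prime pQ).
elim: n z => [|n IH] z.
  by have [d [x e]] := f_frac z; exists d, x.
have [C0 [CD CM]] := ideal_pow_ideal n.+1 iC.
apply: (@ideal_mul_min S Q (ideal_pow Q n) (fun z => exists d x,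
  f a ^+ d * z = f x /\ ideal_pow (contraction Q) n.+1 x)).
- by exists 0%N, 0; rewrite mulr0 rmorph0.
- move=> u w [d [x [ex hx]]] [e [y [ey hy]]].
  exists (d + e)%N, (a ^+ e * x + a ^+ d * y); split.
    by rewrite rmorphD !rmorphM !rmorphXn -ex -ey exprD; ring.
  by apply: CD; apply: CM.
- move=> u w Qu /IH [e [y [ey hy]]].
  have [d [x ex]] := f_frac u.
  exists (d + e)%N, (x * y); split; first by rewrite rmorphM -ex -ey exprD; ring.
  apply: ideal_mulM => //; rewrite /contraction -ex.
  exact: (proj2 (proj2 (proj1 pQ))).
Qed.

Lemma contraction_ideal_pow Q n x :
  prime_ideal Q -> ideal_pow (contraction Q) n x -> ideal_pow Q n (f x).
Proof.
move=> pQ; elim: n x => // n IH x.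
have [I0 [ID _]] := ideal_pow_ideal n.+1 (proj1 pQ).
apply: (@ideal_mul_min R (contraction Q) (ideal_pow (contraction Q) n)
  (fun x => ideal_pow Q n.+1 (f x))).
- by rewrite rmorph0.
- by move=> y z; rewrite rmorphD; exact: ID.
- by move=> y z Qy hz; rewrite rmorphM; apply: ideal_mulM => //; exact: IH.
Qed.

(** Powers of [a] used to clear denominators lie outside the contraction of Q and are absorbed by
    the multiplier that a symbolic power allows. *)
Lemma symb_pow_contraction Q n x : prime_ideal Q -> ~ Q (f a) ->
  symb_pow Q n (f x) <-> symb_pow (contraction Q) n x.
Proof.
move=> pQ nQa; have [[_ [_ QM]] [_ QP]] := pQ.
have pC := contraction_prime pQ.
split=> [[s [Qs hs]]|[s [Qs hs]]]; last first.
  by exists (f s); split=> //; rewrite -rmorphM; exact: contraction_ideal_pow.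
have [d [y [ey hy]]] := ideal_pow_contraction pQ hs.
have [e [t et]] := f_frac s.
exists (a ^+ d * t); split.
  move=> /(proj2 (proj2 pC)) [/(prime_ideal_exp pC) //|].
  by rewrite /contraction -et => /QP [/(prime_ideal_exp pQ)|].
rewrite (_ : _ * x = a ^+ e * y); first by apply: (proj2 (proj2 (ideal_pow_ideal n (proj1 pC)))).
by apply: rmorph_inj; rewrite !rmorphM !rmorphXn -ey -et; ring.
Qed.

Lemma divf_contraction Q x : height_one Q -> ~ Q (f a) -> x <> 0 ->
  divf (f x) Q = divf x (contraction Q).
Proof.
move=> hQ nQa x0; have hC := contraction_height_one hQ nQa.
have [n [h1 h2]] := ordP_exists krullR hC x0.
rewrite (divf_ordP hC (conj h1 h2)); apply: divf_ordP => //.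
split=> [|/(symb_pow_contraction _ _ (proj1 hQ) nQa)//].
by apply/symb_pow_contraction => //; case: hQ.
Qed.

Definition transport_div (D : (R -> Prop) -> int) Q : int :=
  if `[< height_one Q /\ ~ Q (f a) >] then D (contraction Q) else 0.

Lemma transport_divE D Q : height_one Q -> ~ Q (f a) ->
  transport_div D Q = D (contraction Q).
Proof. by move=> hQ nQa; rewrite /transport_div asboolT. Qed.

Lemma transport_divisor D : divisor D -> divisor (transport_div D).
Proof.
move=> [hD [l hl]]; split.
  by move=> Q nQ; rewrite /transport_div asboolF // => -[].
exists (List.map extension l) => Q; rewrite /transport_div.
case: asboolP => // -[hQ nQa] /hl h; apply/List.in_map_iff.
by exists (contraction Q); split=> //; apply: contractionK => //; case: hQ.
Qed.

(** The difference D - D' is supported on primes containing a', each of which contains a prime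
    element; such a divisor is principal. Thus divisor classes need to be compared only away from
    a'. *)
Lemma principal_div_off D a' : krull R -> divisor D ->
  (forall P, height_one P -> P a' -> exists p, prime_elt p /\ P p) ->
  (exists D', [/\ divisor D', principal_div D' &
     forall P, height_one P -> ~ P a' -> D P = D' P]) -> principal_div D.
Proof.
move=> kR hD prm [D' [hD' pD' eD]].
apply: (principal_div_add kR pD' (D2 := fun P => D P - D' P)); last first.
  by move=> P; rewrite addrC subrK.
apply: (principal_div_of_primes kR); first exact: divisorB.
move=> P DP; have hP : height_one P.
  by apply: contrapT => nP; apply: DP; rewrite (proj1 hD) // (proj1 hD') // subrr.
by apply: (prm _ hP); apply: contrapT => nPa; apply: DP; rewrite eD // subrr.
Qed.

End NagataClassGroup.

Lemma nagata_cl_iso (R S : comPzRingType) (f : {rmorphism R -> S}) (a : R) :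
  krull R -> krull S -> a <> 0 ->
  (forall x, f x = 0 -> x = 0) ->
  (forall z, exists d x, f a ^+ d * z = f x) ->
  (forall P, height_one P -> P a -> exists p, prime_elt p /\ P p) ->
  (forall Q, height_one Q -> Q (f a) -> exists p, prime_elt p /\ Q p) ->
  cl_iso R S.
Proof.
move=> kR kS a0 f0 ff prmR prmS.
have [domR domS] := (proj1 kR, proj1 kS).
have fa0 : f a <> 0 by move=> /f0.
have fn0 x : x <> 0 -> f x <> 0 by move=> x0 /f0.
exists (transport_div f a); split; first by move=> D; exact: transport_divisor.
split.
  move=> D1 D2 _ _; apply: funext => Q; rewrite /transport_div.
  by case: ifP => // _; rewrite addr0.
split.
  move=> D hD /(principal_divP kR) [x [y [x0 y0 h]]].
  apply: (principal_div_off kS (transport_divisor ff hD) prmS).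
  exists (fun Q => divf (f x) Q - divf (f y) Q); split.
  - by apply: divisorB; apply: divisor_divf => //; exact: fn0.
  - by apply/(principal_divP kS); exists (f x), (f y); split=> //; exact: fn0.
  - by move=> Q hQ nQ; rewrite transport_divE // h !(divf_contraction kR kS f0 ff).
split.
  (* Surjectivity on classes: D' is pulled back along [extension] and set to 0 at primes containing
     a. *)
  move=> D' hD'; have [h0 [l hl]] := hD'.
  pose D P := if `[< height_one P /\ ~ P a >] then D' (extension f a P) else 0.
  have hD : divisor D.
    split; first by move=> P nP; rewrite /D asboolF // => -[].
    exists (List.map (contraction f) l) => P; rewrite /D.
    case: asboolP => // -[hP nPa] /hl h; apply/List.in_map_iff.
    exists (extension f a P); split=> //.
    by apply: (extensionK f0) => //; case: hP.
  exists D; split=> //.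
  apply: (principal_div_off kS (divisorB hD' (transport_divisor ff hD)) prmS).
  exists (fun _ => 0); split.
  - by split=> //; exists [::].
  - apply/(principal_divP kS); exists 1, 1; split; try exact: dom_neq10.
    by move=> P; rewrite subrr.
  - move=> Q hQ nQ; rewrite transport_divE // /D asboolT.
      by rewrite (contractionK ff) ?subrr //; case: hQ.
    by split=> //; exact: (contraction_height_one kS f0 ff).
(* Injectivity on classes: z and w live in S; powers of [f a] carry them to images of x and y in R
   and alter divisors only at primes containing [f a]. *)
move=> D hD /(principal_divP kS) [z [w [z0 w0 h]]].
have [d [x ex]] := ff z; have [e [y ey]] := ff w.
have x0 : x <> 0.
  move=> x0; move: (dom_mulf_neq0 domS (dom_expf_neq0 domS (n:=d) fa0) z0).
  by rewrite ex x0 rmorph0.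
have y0 : y <> 0.
  move=> y0; move: (dom_mulf_neq0 domS (dom_expf_neq0 domS (n:=e) fa0) w0).
  by rewrite ey y0 rmorph0.
apply: (principal_div_off kR hD prmR).
exists (fun P => divf x P - divf y P); split.
- by apply: divisorB; exact: divisor_divf.
- by apply/(principal_divP kR); exists x, y.
move=> P hP nPa; have pP := proj1 hP.
have hE := extension_height_one kS f0 ff hP nPa.
have nE : ~ extension f a P (f a) by move=> /(extensionP f0 _ pP nPa).
have vfa : divf (f a) (extension f a P) = 0 by apply/(divf_eq0 kS hE).
have := h (extension f a P); rewrite transport_divE // (extensionK f0) // => ->.
rewrite -[in divf x P](extensionK f0 pP nPa) -[in divf y P](extensionK f0 pP nPa).
rewrite -!(divf_contraction kR kS f0 ff) // -ex -ey.
rewrite !(divfM kS) //; try exact: (dom_expf_neq0 domS).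
by rewrite !(divfX kS) // vfa !mulr0 !add0r.
Qed.

Lemma cl_iso_principal (R S : comPzRingType) : krull R -> krull S -> cl_iso R S ->
  (forall D : (R -> Prop) -> int, divisor D -> principal_div D) <->
  (forall D : (S -> Prop) -> int, divisor D -> principal_div D).
Proof.
move=> kR kS [phi [h1 [_ [h3 [h4 h5]]]]]; split=> h D hD.
  have [D0 [hD0 pD]] := h4 _ hD.
  apply: (principal_div_add kS pD (h3 _ hD0 (h _ hD0))).
  by move=> P; rewrite subrK.
by apply: h5 => //; apply: h; exact: h1.
Qed.

Lemma cl_iso_ufd (R S : comPzRingType) : krull R -> krull S -> cl_iso R S ->
  ufd S <-> ufd R.
Proof.
move=> kR kS iso; have h := cl_iso_principal kR kS iso; split=> u.
  by apply: (principal_div_ufd kR); apply/h => D; exact: ufd_principal_div.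
by apply: (principal_div_ufd kS); apply/h => D; exact: ufd_principal_div.
Qed.

(** Needed for the finiteness clause of [krull] when valuations are indexed by subtypes. *)
Lemma list_sig (T : Type) (Q : T -> Prop) (l : list T) :
  exists l' : list {x | Q x}, forall j, List.In (sval j) l -> List.In j l'.
Proof.
elim: l => [|x l [l' h]]; first by exists nil.
have [Qx|nQx] := pselect (Q x).
  exists (exist Q x Qx :: l') => -[y Qy] /= [e|hy]; last by right; exact: h.
  by left; subst y; rewrite (Prop_irrelevance Qx Qy).
by exists l' => -[y Qy] /= [e|hy]; [case: nQx; rewrite e|exact: h].
Qed.

Lemma leq_sum_mem (I : Type) (l : seq I) (g : I -> nat) i :
  List.In i l -> (g i <= \sum_(j <- l) g j)%N.
Proof.
elim: l => //= j l IH; rewrite big_cons => -[->|/IH]; first exact: leq_addr.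
by move=> h; apply: leq_trans h (leq_addl _ _).
Qed.

(** * Prime-adic valuations and Krull extensions *)

Section PrimeAdic.
Variables (R : comPzRingType) (p : R).
Hypotheses (domR : is_domain R) (pp : prime_elt p).

Definition padic (w : R -> nat) : Prop :=
  forall z j, z <> 0 -> dvdR (p ^+ j) z <-> (j <= w z)%N.

Lemma padic_exists : (forall z, (forall n, dvdR (p ^+ n) z) -> z = 0) ->
  exists w, padic w.
Proof.
move=> capp.
have dec i j z : (i <= j)%N -> dvdR (p ^+ j) z -> dvdR (p ^+ i) z.
  move=> /subnK <-; rewrite exprD => -[c ->]; exists (p ^+ (j - i) * c); ring.
have [w hw] : {w : R -> nat & forall z, z <> 0 ->
    dvdR (p ^+ w z) z /\ ~ dvdR (p ^+ (w z).+1) z}.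
  apply: (@choice _ _ (fun z n => z <> 0 -> dvdR (p ^+ n) z /\ ~ dvdR (p ^+ n.+1) z)) => z.
  have [->|/eqP z0] := eqVneq z 0; first by exists 0%N.
  have [|n [hn minn]] := @argmin_nat nat (fun n => ~ dvdR (p ^+ n) z) id.
    by apply/existsNP => /capp.
  case: n hn minn => [|n] hn minn; first by case: hn; exists z; rewrite mul1r.
  exists n => _; split=> //; apply: contrapT => /minn; lia.
exists w => z j z0; have [h1 h2] := hw _ z0; split=> [hj|lej]; last exact: dec h1.
by rewrite leqNgt; apply/negP => lt; apply: h2; apply: dec hj.
Qed.

Variable w : R -> nat.
Hypothesis wP : padic w.

Lemma padic_dvd z : z <> 0 -> dvdR p z <-> (0 < w z)%N.
Proof. by move=> z0; have := wP 1 z0; rewrite expr1. Qed.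

Lemma padicM x y : x <> 0 -> y <> 0 -> w (x * y) = (w x + w y)%N.
Proof.
move=> x0 y0; have xy0 := dom_mulf_neq0 domR x0 y0.
have [p0 [_ pP]] := pp.
have [c ec] := (wP _ x0).2 (leqnn _); have [d ed] := (wP _ y0).2 (leqnn _).
have nc z e n : z <> 0 -> n = w z -> z = p ^+ n * e -> ~ dvdR p e.
  move=> z0 -> ez [k ek]; have : dvdR (p ^+ (w z).+1) z.
    by exists k; rewrite [LHS]ez ek exprSr mulrA.
  by move=> /(wP _ z0); rewrite ltnn.
apply/eqP; rewrite eqn_leq; apply/andP; split; last first.
  by apply/wP => //; exists (c * d); rewrite exprD [in LHS]ec [in LHS]ed; ring.
rewrite leqNgt; apply/negP => /(wP _ xy0) [k ek].
have : dvdR p (c * d).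
  exists k; apply: (dom_mulfI domR (dom_expf_neq0 domR (n:=(w x + w y)%N) p0)).
  transitivity (x * y); last by rewrite ek exprSr mulrA.
  by rewrite exprD [in RHS]ec [in RHS]ed; ring.
by move=> /pP [/(nc _ _ _ x0 erefl ec)|/(nc _ _ _ y0 erefl ed)].
Qed.

Lemma padicD x y : x <> 0 -> y <> 0 -> x + y <> 0 ->
  (minn (w x) (w y) <= w (x + y)%R)%N.
Proof.
move=> x0 y0 xy0; apply/wP => //; apply: dvdRD.
  by apply/wP => //; exact: geq_minl.
by apply/wP => //; exact: geq_minr.
Qed.

End PrimeAdic.

(** The family on S has two kinds of members: each v_i with v_i(a) = 0, evaluated on numerators, and
    the p-adic valuation of each prime factor of [f a] that is separated. *)
Lemma krull_extension (R S : comPzRingType) (f : {rmorphism R -> S}) (a : R)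
    (u : S) (t : seq S) :
  krull R -> is_domain S ->
  (forall x, f x = 0 -> x = 0) ->
  (forall z, exists d x, f a ^+ d * z = f x) ->
  f a <> 0 -> unitR u -> f a = u * \prod_(p <- t) p ->
  (forall p, List.In p t -> unitR p \/
     prime_elt p /\ forall z, (forall n, dvdR (p ^+ n) z) -> z = 0) ->
  krull S.
Proof.
move=> [domR [I [v [vM [vD [vnt [vfin vdvd]]]]]]] domS f0 ff fa0 uu ea ht.
have fI x y : f x = f y -> x = y by exact: rmorph_inj.
have fn0 x : x <> 0 -> f x <> 0 by move=> x0 /f0.
have a0 : a <> 0 by move=> e; apply: fa0; rewrite e rmorph0.
have fan0 n := dom_expf_neq0 domS (n:=n) fa0.
have num_neq0 z d x : z <> 0 -> f a ^+ d * z = f x -> x <> 0.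
  by move=> z0 e x0; apply: (dom_mulf_neq0 domS (fan0 d) z0); rewrite e x0 rmorph0.
have van i n x : v i a = 0%N -> x <> 0 -> v i (a ^+ n * x) = v i x.
  move=> va x0; rewrite vM // ?(valX domR vM) //; last exact: dom_expf_neq0.
  by rewrite va muln0.
pose QI i := v i a = 0%N.
pose QP p := List.In p t /\ prime_elt p /\ forall z, (forall n, dvdR (p ^+ n) z) -> z = 0.
pose isval (i : {i | QI i} + {p | QP p}) (w : S -> nat) : Prop :=
  match i with
  | inl i => forall z d x, z <> 0 -> f a ^+ d * z = f x -> w z = v (sval i) x
  | inr p => padic (sval p) w
  end.
have [w hw] : {w : _ -> S -> nat & forall i, isval i (w i)}.
  apply: choice => -[[i vi]|[p hp]] /=; last exact: padic_exists (proj2 (proj2 hp)).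
  have [g hg] := choice (fun z => ff z).
  have [x hx] := choice hg.
  exists (fun z => v i (x z)) => z d y z0 e.
  have [xz0 y0] := (num_neq0 _ _ _ z0 (hx z), num_neq0 _ _ _ z0 e).
  (* Two numerators of z differ by powers of a, on which v_i vanishes, so the value does not depend
     on the choice. *)
  have : a ^+ d * x z = a ^+ g z * y.
    by apply: fI; rewrite !rmorphM !rmorphXn -hx -e; ring.
  by move=> /(congr1 (v i)); rewrite !van.
split=> //; exists ({i | QI i} + {p | QP p})%type, w; split; [|split; [|split; [|split]]].
- move=> [i|p] z1 z2 z10 z20; last first.
    by have [_ [pp _]] := svalP p; exact: (padicM domS pp (hw (inr p))).
  have [d [x ex]] := ff z1; have [e [y ey]] := ff z2.
  rewrite (hw (inl i) _ _ _ z10 ex) (hw (inl i) _ _ _ z20 ey) -vM.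
  + apply: (hw (inl i) _ (d + e)%N) => //; first exact: dom_mulf_neq0.
    by rewrite rmorphM -ex -ey exprD; ring.
  + exact: num_neq0 ex.
  + exact: num_neq0 ey.
- move=> [i|p] z1 z2 z10 z20 z120; last exact: (padicD (hw (inr p))).
  have [d [x ex]] := ff z1; have [e [y ey]] := ff z2.
  have [x0 y0] := (num_neq0 _ _ _ z10 ex, num_neq0 _ _ _ z20 ey).
  have exy : f a ^+ (d + e) * (z1 + z2) = f (a ^+ e * x + a ^+ d * y).
    by rewrite rmorphD !rmorphM !rmorphXn -ex -ey exprD; ring.
  rewrite (hw (inl i) _ _ _ z10 ex) (hw (inl i) _ _ _ z20 ey) (hw (inl i) _ _ _ z120 exy).
  rewrite -(van (sval i) e x (svalP i) x0) -(van (sval i) d y (svalP i) y0).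
  apply: vD; [| |exact: num_neq0 exy].
  + by apply: dom_mulf_neq0 => //; exact: dom_expf_neq0.
  + by apply: dom_mulf_neq0 => //; exact: dom_expf_neq0.
- move=> [i|[p hp]].
    have [x [x0 hx]] := vnt (sval i); exists (f x); split; first exact: fn0.
    by rewrite (hw (inl i) _ 0%N x) //; [exact: fn0|rewrite mul1r].
  have [_ [[p0 _] _]] := hp.
  exists p; split=> //; apply/(padic_dvd (hw (inr (exist _ p hp))) p0).
  exact: dvdR_refl.
- move=> z z0; have [d [x ex]] := ff z.
  have [l hl] := vfin _ (num_neq0 _ _ _ z0 ex).
  have [l1 h1] := list_sig QI l; have [l2 h2] := list_sig QP t.
  exists (List.map inl l1 ++ List.map inr l2) => -[i|p] hi; apply/List.in_app_iff.
    left; apply/List.in_map_iff; exists i; split=> //; apply/h1/hl.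
    by rewrite -(hw (inl i) _ _ _ z0 ex).
  by right; apply/List.in_map_iff; exists p; split=> //; apply/h2; case: (svalP p).
- move=> z y z0 y0 le.
  have [d [x ex]] := ff z; have [e [x' ex']] := ff y.
  have [x0 x'0] := (num_neq0 _ _ _ z0 ex, num_neq0 _ _ _ y0 ex').
  have [l hl] := vfin _ x'0.
  (* This n bounds every [v i x'], so a^n dominates x' at each valuation positive on a; the
     remaining valuations are covered by [le]. *)
  pose n := (\sum_(i <- l) v i x')%N.
  have an0 := dom_expf_neq0 domR (n:=n) a0.
  have [c ec] : dvdR x' (a ^+ n * x).
    apply: vdvd => //; first exact: dom_mulf_neq0.
    move=> i; rewrite vM // (valX domR vM) //.
    have [vi|/eqP vi] := eqVneq (v i a) 0%N.
      have := le (inl (exist QI i vi)).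
      rewrite (hw (inl (exist QI i vi)) _ _ _ z0 ex) (hw (inl (exist QI i vi)) _ _ _ y0 ex') /=.
      by lia.
    have [->//|/eqP /hl /(leq_sum_mem (v^~ x'))] := eqVneq (v i x') 0%N.
    by rewrite -/n; nia.
  have yd : dvdR y (f a ^+ (n + d) * z).
    exists (f a ^+ e * f c); rewrite exprD -mulrA ex -rmorphXn -rmorphM ec rmorphM -ex'.
    ring.
  (* [G q] says that q can be cancelled when y divides q times a multiple of z; the cofactor k makes
     [G] multiplicative. For a p-adic factor, p (k z) = y m and w(y) <= w(z) force p to divide m. *)
  pose G q := q <> 0 /\ forall k, k <> 0 -> dvdR y (q * (k * z)) -> dvdR y (k * z).
  have unit_neq0 (q : S) : unitR q -> q <> 0.
    by move=> [k ek] q0; apply: (dom_neq10 domS); move: ek; rewrite q0 mul0r.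
  have GU (q : S) : unitR q -> G q.
    move=> uq; split; first exact: unit_neq0.
    move=> k k0; have [q' eq'] := uq => -[m em]; exists (m * q').
    by rewrite mulrA -em mulrAC -eq' mul1r.
  have GM q1 q2 : G q1 -> G q2 -> G (q1 * q2).
    move=> [q10 h1] [q20 h2]; split; first exact: dom_mulf_neq0.
    move=> k k0; rewrite -mulrA (mulrA q2) => /h1 h.
    by apply: h2 => //; rewrite mulrA; apply: h; exact: dom_mulf_neq0.
  have Gt p : List.In p t -> G p.
    move=> pt; have [/GU //|[pp cap]] := ht _ pt.
    have p0 : p <> 0 by case: pp.
    split=> // k k0 [m em].
    have kz0 := dom_mulf_neq0 domS k0 z0.
    have m0 : m <> 0.
      by move=> m0; apply: (dom_mulf_neq0 domS p0 kz0); rewrite em m0 mulr0.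
    pose i : {p | QP p} := exist QP p (conj pt (conj pp cap)).
    have wi : padic p (w (inr i)) := hw (inr i).
    have := congr1 (w (inr i)) em; rewrite !(padicM domS pp wi) //.
    have := le (inr i); have := (padic_dvd wi p0).1 (dvdR_refl p) => l1 l2 l3.
    have [|m' em'] := (padic_dvd wi m0).2; first by lia.
    exists m'; apply: (dom_mulfI domS p0).
    by rewrite em em' mulrCA.
  have Ga : G (f a).
    rewrite ea; apply: (GM); first exact: GU.
    elim: (t) Gt => [|p s IH] h; first by rewrite big_nil; apply: GU; exact: dvdR_refl.
    rewrite big_cons; apply: GM; first by apply: h; left.
    by apply: IH => q hq; apply: h; right.
  have GX N : G (f a ^+ N).
    elim: N => [|N IH]; first by apply: GU; exact: dvdR_refl.
    by rewrite exprS; exact: GM.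
  have := (GX (n + d)%N).2 1 (dom_neq10 domS); rewrite mul1r; exact.
Qed.

(** * Powers of ideals and polynomials with coefficients in an ideal *)

Lemma gen2_ideal (R : comPzRingType) (p b : R) : ideal (gen2 p b).
Proof.
split; first by exists 0, 0; rewrite !mulr0 addr0.
split=> [_ _ [x [y ->]] [x' [y' ->]]|r _ [x [y ->]]].
  by exists (x + x'), (y + y'); ring.
by exists (r * x), (r * y); ring.
Qed.

Lemma ideal_pow_leq (R : comPzRingType) (P : R -> Prop) m n x : ideal P ->
  (m <= n)%N -> ideal_pow P n x -> ideal_pow P m x.
Proof.
move=> iP /subnK <-; elim: (n - m)%N => [//|k IH].
by rewrite addSn => /(ideal_powS iP).
Qed.

Lemma ideal_powXM (R : comPzRingType) (P : R -> Prop) m n x y :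
  P x -> ideal_pow P n y -> ideal_pow P (m + n) (x ^+ m * y).
Proof.
move=> Px hy; elim: m => [|m IH]; first by rewrite mul1r.
by rewrite exprS -mulrA; exact: ideal_mulM.
Qed.

(** As in Gauss's lemma: if g_m and h_n are the lowest coefficients outside P, every other term of
    the coefficient of degree m + n lies in P. *)
Lemma prime_ideal_coef (A : comNzRingType) (P : A -> Prop) (g h : {poly A}) :
  prime_ideal P -> (forall i, P (g * h)`_i) ->
  (forall i, P g`_i) \/ (forall i, P h`_i).
Proof.
move=> [iP [P1 PM]] gh; apply: contrapT => /not_orP [/existsNP ng /existsNP nh].
have [m [nm minm]] := argmin_nat id ng.
have [n [nn minn]] := argmin_nat id nh.
have gP j : (j < m)%N -> P g`_j by move=> lt; apply: contrapT => /minm; lia.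
have hP j : (j < n)%N -> P h`_j by move=> lt; apply: contrapT => /minn; lia.
have ltm : (m < (m + n).+1)%N by lia.
have [P0 [PD Pm]] := iP.
have := gh (m + n)%N; rewrite coefM (bigD1 (Ordinal ltm)) //= addKn => hs.
suff : P (g`_m * h`_n) by move=> /PM [].
rewrite -[X in P X](addrK (\sum_(i < (m + n).+1 | i != Ordinal ltm) g`_i * h`_(m + n - i))).
apply: (PD) => //; rewrite -mulN1r; apply: (Pm).
apply: (@big_ind _ P) => [//|x y|i]; first exact: PD.
rewrite -val_eqE /= => im.
have [lt|lt] := ltnP i m; first by rewrite mulrC; apply: Pm; exact: gP.
by apply: Pm; apply: hP; have := ltn_ord i; lia.
Qed.

Lemma poly_gen2 (A : comNzRingType) (p b : A) (g : {poly A}) :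
  (forall i, gen2 p b g`_i) -> exists k l, g = p%:P * k + b%:P * l.
Proof.
move=> /choice [k /choice [l h]].
exists (\poly_(i < size g) k i), (\poly_(i < size g) l i); apply/polyP => i.
rewrite coefD !coefCM !coef_poly; case: ltnP => [_|le]; first exact: h.
by rewrite nth_default // !mulr0 addr0.
Qed.

(** * The ring A[X]/(aX - b) *)

Section QuotientByLinear.
Variables (A : idomainType) (a b : A) (S : comPzRingType) (pi : {rmorphism {poly A} -> S}).
Hypothesis pi_surj : forall y : S, exists g, pi g = y.
Hypothesis pi_ker : forall g, pi g = 0 <-> exists h, g = (a%:P * 'X - b%:P) * h.
Hypotheses (a0 : a != 0) (b0 : b != 0).
Hypothesis coprime_ab : forall x, dvdR a x -> dvdR b x -> dvdR (a * b) x.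
Implicit Types (x y p q : A) (g h : {poly A}).

Definition base : {rmorphism A -> S} := pi \o polyC.

Let f := base.

Lemma base_pi x : f x = pi x%:P. Proof. by []. Qed.

Lemma base_X : f a * pi 'X = f b.
Proof.
apply/eqP; rewrite -subr_eq0; apply/eqP.
rewrite !base_pi -rmorphM -rmorphB; apply/pi_ker; exists 1; by rewrite mulr1.
Qed.

Lemma idomain_is_domain : is_domain A.
Proof.
split; first exact: oner_neq0.
by move=> x y /eqP; rewrite mulf_eq0 => /orP [/eqP|/eqP]; [left|right].
Qed.

Lemma coprime_dvd x : dvdR a (b * x) -> dvdR a x.
Proof.
move=> h; have [|c e] := coprime_ab h; first by exists x.
exists c; apply: (mulfI b0); by rewrite e mulrCA mulrA.
Qed.

(** If a g = (aX - b) h, then a divides each b h_i, hence each h_i by coprimality, and cancelling a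
    puts g in the kernel. The ideal aA is written [gen2 a 0] so that [poly_gen2] applies. *)
Lemma base_regular z : f a * z = 0 -> z = 0.
Proof.
have [g <-] := pi_surj z; rewrite base_pi -rmorphM => /pi_ker [h e].
have ah i : gen2 a 0 h`_i.
  suff /coprime_dvd [c ->] : dvdR a (b * h`_i) by exists c, 0; rewrite mulr0 addr0.
  have := congr1 (fun r : {poly A} => r`_i) e.
  rewrite mulrBl coefB -mulrA !coefCM -commr_polyX coefMX => e'.
  (* Degree i of the relation reads a g_i = a h_(i-1) - b h_i. *)
  exists ((if i == 0%N then 0 else h`_i.-1) - g`_i).
  by rewrite mulrBr e' subKr.
have [k [l ek]] := poly_gen2 ah.
apply/pi_ker; exists k; apply: (@mulfI _ a%:P); first by rewrite polyC_eq0.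
by rewrite e ek mul0r addr0; ring.
Qed.

Lemma base_eq0 x : f x = 0 -> x = 0.
Proof.
rewrite base_pi => /pi_ker [g e]; apply/eqP; rewrite -polyC_eq0 e.
have [->|g0] := eqVneq g 0; first by rewrite mulr0.
have sl : size (a%:P * 'X - b%:P) = 2.
  by rewrite -polyCN size_MXaddC polyC_eq0 (negbTE a0) size_polyC a0.
have l0 : a%:P * 'X - b%:P != 0 by rewrite -size_poly_eq0 sl.
have := congr1 (fun r : {poly A} => size r) e.
rewrite size_mul // sl size_polyC; have : (size g != 0)%N by rewrite size_poly_eq0.
by case: (x != 0); lia.
Qed.

Lemma base_frac z : exists d x, f a ^+ d * z = f x.
Proof.
have [g <-] := pi_surj z; elim/poly_ind: g => [|g c [d [x e]]].
  by exists 0%N, 0; rewrite !rmorph0 mulr0.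
exists d.+1, (x * b + a ^+ d.+1 * c).
rewrite !rmorphD !rmorphM -base_X !rmorphXn -e base_pi exprS; ring.
Qed.

Lemma quotient_domain : is_domain S.
Proof.
have reg d z : f a ^+ d * z = 0 -> z = 0.
  elim: d => [|d IH]; first by rewrite mul1r.
  by rewrite exprS -mulrA => /base_regular.
split.
  apply/negP => /eqP e; have : (1 : A) = 0 by apply: base_eq0; rewrite rmorph1.
  by apply/eqP; exact: oner_neq0.
move=> z w e; have [d [x ex]] := base_frac z; have [k [y ey]] := base_frac w.
have : f (x * y) = 0.
  rewrite rmorphM -ex -ey (_ : _ * _ = f a ^+ d * f a ^+ k * (z * w)); last by ring.
  by rewrite e mulr0.
move=> /base_eq0 /(proj2 idomain_is_domain) [x0|y0]; [left|right].
  by apply: (reg d); rewrite ex x0 rmorph0.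
by apply: (reg k); rewrite ey y0 rmorph0.
Qed.

(** Modulo a divisor p of a the relation aX - b becomes -b, so a multiple of p has coefficients in
    (p, b); conversely b = aX is a multiple of p in the quotient. *)
Lemma dvd_pi p g : dvdR p a -> dvdR (f p) (pi g) <-> forall i, gen2 p b g`_i.
Proof.
move=> [c ec]; have [I0 [ID IM]] := gen2_ideal p b; split=> [[z]|/poly_gen2 [k [l ->]]].
  have [h <-] := pi_surj z; rewrite base_pi -rmorphM => e.
  have /pi_ker [k] : pi (g - p%:P * h) = 0 by rewrite rmorphB e subrr.
  move=> /(congr1 (fun r => r + p%:P * h)); rewrite subrK => -> i.
  rewrite coefD mulrBl coefB -mulrA !coefCM; apply: ID; last first.
    by exists h`_i, 0; rewrite mulr0 addr0.
  exists (c * ('X * k)`_i), (- k`_i); rewrite ec; ring.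
rewrite rmorphD !rmorphM -!base_pi -base_X; apply: dvdRD.
  by exists (pi k).
by exists (f c * pi 'X * pi l); rewrite [in LHS]ec rmorphM; ring.
Qed.

Lemma base_prime p : prime_elt p -> dvdR p a -> prime_ideal (gen2 p b) -> prime_elt (f p).
Proof.
move=> [p0 _] pa pI; have [_ [I1 _]] := pI.
split; first by move=> /base_eq0.
split.
  by rewrite /unitR -(rmorph1 pi) => /(dvd_pi _ pa) /(_ 0%N); rewrite coef1.
move=> z w; have [g <-] := pi_surj z; have [h <-] := pi_surj w.
rewrite -rmorphM => /(dvd_pi _ pa) /(prime_ideal_coef pI) [H|H]; [left|right].
  exact/dvd_pi.
exact/dvd_pi.
Qed.

Lemma base_unit p : dvdR p a -> (exists x y, p * x + b * y = 1) -> unitR (f p).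
Proof.
move=> [c ec] [x [y e]]; exists (f x + f c * pi 'X * f y).
by rewrite -(rmorph1 f) -e rmorphD !rmorphM -base_X [in LHS]ec rmorphM; ring.
Qed.

Section Separated.
Variables (p a1 : A) (e : nat).
Hypotheses (p0 : p <> 0) (pI : prime_ideal (gen2 p b)) (e_gt0 : (0 < e)%N).
Hypotheses (ea : a = p ^+ e * a1) (a1I : ~ gen2 p b a1).

(* p and b = p^e a1 X have weights 1 and e; [weighted m] is the ideal spanned
   by the monomials p^i b^j of weight at least m. *)
Definition weighted_sum m g : A :=
  \sum_(j < size g) g`_j * p ^+ (m - e * j) * b ^+ j.

Definition weighted m y : Prop := exists g, y = weighted_sum m g.

Lemma weighted_sum_wide m g n : (size g <= n)%N ->
  weighted_sum m g = \sum_(j < n) g`_j * p ^+ (m - e * j) * b ^+ j.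
Proof.
move=> le; rewrite /weighted_sum.
rewrite (big_ord_widen n (fun j => g`_j * p ^+ (m - e * j) * b ^+ j) le) big_mkcond.
apply: eq_bigr => j _; case: ltnP => // ge.
by rewrite nth_default // !mul0r.
Qed.

Lemma weightedD m x y : weighted m x -> weighted m y -> weighted m (x + y).
Proof.
move=> [g ->] [h ->]; exists (g + h).
have le := size_polyD g h.
rewrite (weighted_sum_wide _ le) (weighted_sum_wide m (leq_maxl (size g) (size h))).
rewrite (weighted_sum_wide m (leq_maxr (size g) (size h))) -big_split.
by apply: eq_bigr => j _; rewrite coefD /= !mulrDl.
Qed.

Lemma weighted_mono m c i j : (m <= i + e * j)%N -> weighted m (c * p ^+ i * b ^+ j).
Proof.
move=> le; exists ((c * p ^+ (i - (m - e * j))) *: 'X^j).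
have sz : (size ((c * p ^+ (i - (m - e * j))) *: 'X^j : {poly A}) <= j.+1)%N.
  by apply: leq_trans (size_scale_leq _ _) _; rewrite size_polyXn.
rewrite (weighted_sum_wide m sz) big_ord_recr /= big1 ?add0r.
  by rewrite coefZ coefXn eqxx mulr1; congr (_ * _); rewrite -mulrA -exprD subnK //; lia.
by move=> k _; rewrite coefZ coefXn ltn_eqF // mulr0 !mul0r.
Qed.

(** Substitute b = p^e a1 X. Subtraction is truncated: m - ej and ej - m are never both positive,
    and (m - ej) + ej = m + (ej - m). *)
Lemma base_weighted m g : f (weighted_sum m g) =
  f p ^+ m * pi (\poly_(j < size g) (g`_j * a1 ^+ j * p ^+ (e * j - m))).
Proof.
rewrite /weighted_sum rmorph_sum poly_def rmorph_sum mulr_sumr.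
apply: eq_bigr => j _; rewrite -mul_polyC [pi (_ * _)]rmorphM [pi ('X^j)]rmorphXn -base_pi.
have eb : f b = f p ^+ e * f a1 * pi 'X by rewrite -base_X [in LHS]ea rmorphM rmorphXn.
rewrite -/f !rmorphM ![f (_ ^+ _)]rmorphXn eb !exprMn -exprM.
transitivity (f p ^+ (m - e * j + e * j) * (f g`_j * f a1 ^+ j * pi 'X ^+ j)).
  by rewrite exprD; ring.
rewrite (_ : m - e * j + e * j = m + (e * j - m))%N; last by lia.
by rewrite exprD; ring.
Qed.

(** Terms with ej > m already have weight above m. For ej <= m the reduced coefficient is g_j a1^j;
    divisibility by p puts it in (p, b), and a1 outside this prime forces g_j into it. Writing g_j =
    p x + b x' raises the weight, as e > 0. *)
Lemma weighted_step m y z : f y = f p ^+ m * z -> weighted m y.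
Proof.
elim: m z => [|m IH] z ey.
  exists y%:P; rewrite (weighted_sum_wide _ (n:=1)) ?size_polyC ?leq_b1 //.
  by rewrite big_ord1 coefC /= !mulr1.
have [|g eg] := IH (f p * z); first by rewrite ey exprSr mulrA.
have pa : dvdR p a by exists (p ^+ e.-1 * a1); rewrite mulrA -exprS prednK.
have fpm : f p ^+ m <> 0.
  by apply: (dom_expf_neq0 quotient_domain) => /base_eq0.
have : dvdR (f p) (pi (\poly_(j < size g) (g`_j * a1 ^+ j * p ^+ (e * j - m)))).
  exists z; apply: (dom_mulfI quotient_domain fpm).
  by rewrite -base_weighted -eg ey exprSr mulrA.
move=> /(dvd_pi _ pa) hI; rewrite eg /weighted_sum.
have w0 : weighted m.+1 0 by exists 0; rewrite /weighted_sum size_poly0 big_ord0.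
apply: (@big_ind _ (weighted m.+1)) => [//|x x'|j _]; first exact: weightedD.
have [lt|le] := ltnP m (e * j); first by apply: weighted_mono; lia.
have := hI j; rewrite coef_poly ltn_ord (_ : e * j - m = 0)%N; last by lia.
have [_ [_ PM]] := pI.
rewrite mulr1 => /PM [|/(prime_ideal_exp pI) //] [x [x' ->]].
have -> : (p * x + b * x') * p ^+ (m - e * j) * b ^+ j =
    x * p ^+ (m - e * j).+1 * b ^+ j + x' * p ^+ (m - e * j) * b ^+ j.+1.
  by rewrite !exprS; ring.
by apply: weightedD; apply: weighted_mono; lia.
Qed.

(** The monomial p^(em - ej) b^j has at least m factors from (p, b), since e >= 1. *)
Lemma weighted_pow m y : weighted (e * m) y -> ideal_pow (gen2 p b) m y.
Proof.
have iI := gen2_ideal p b; have [h0 [hD hM]] := ideal_pow_ideal m iI.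
have Ip : gen2 p b p by exists 1, 0; ring.
have Ib : gen2 p b b by exists 0, 1; ring.
move=> [g ->]; apply: (@big_ind _ (ideal_pow (gen2 p b) m)) => [//|//|j _].
rewrite -mulrA; apply: hM.
apply: (ideal_pow_leq (n := e * m - e * j + j) iI); first by nia.
by apply: ideal_powXM => //; exact: ideal_powX.
Qed.

Lemma base_separated : (forall x, (forall i, ideal_pow (gen2 p b) i x) -> x = 0) ->
  forall z, (forall n, dvdR (f p ^+ n) z) -> z = 0.
Proof.
move=> capI z hz; have [d [x ex]] := base_frac z.
have x0 : x = 0.
  apply: capI => i; apply: weighted_pow.
  have [w ew] := hz (e * i)%N.
  by apply: (@weighted_step _ _ (f a ^+ d * w)); rewrite -ex ew; ring.
have fa : f a ^+ d <> 0.
  by apply: (dom_expf_neq0 quotient_domain) => /base_eq0/eqP; rewrite (negbTE a0).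
by apply: (dom_mulfI quotient_domain fa); rewrite ex x0 rmorph0 mulr0.
Qed.

End Separated.

End QuotientByLinear.

Lemma unit_notin_prime_ideal (R : comPzRingType) (P : R -> Prop) u :
  prime_ideal P -> unitR u -> ~ P u.
Proof.
move=> [[_ [_ PM]] [P1 _]] [t e] Pu; apply: P1.
by rewrite e mulrC; apply: PM.
Qed.

(** Associates of p are collected into the power, their unit quotients going into a1; primality of I
    keeps a1 outside it. *)
Lemma split_prime_power (A : idomainType) (I : A -> Prop) p (s : seq A) :
  prime_ideal I -> p <> 0 -> (forall q, List.In q s -> assocR p q \/ ~ I q) ->
  exists e a1, \prod_(q <- s) q = p ^+ e * a1 /\ ~ I a1.
Proof.
move=> pI p0; have [_ [I1 PM]] := pI.
elim: s => [|q s IH] h; first by exists 0%N, 1; rewrite big_nil mulr1.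
have [|e [a1 [ea Ia]]] := IH; first by move=> r hr; apply: h; right.
rewrite big_cons ea; have [[[w ew] [w' ew']]|nq] := h q (or_introl erefl).
  have ww : 1 = w * w'.
    by apply: (dom_mulfI (@idomain_is_domain A) p0); rewrite mulr1 mulrA -ew.
  exists e.+1, (w * a1); split; first by rewrite ew exprS; ring.
  by move=> /PM [] //; apply: unit_notin_prime_ideal => //; exists w'.
exists e, (q * a1); split; first by rewrite mulrCA.
by move=> /PM [].
Qed.

Theorem theorem3p1 (A : idomainType) (a b : A)
  (A' : comPzRingType) (pi : {rmorphism {poly A} -> A'}) :
  (* A' = A[X]/(aX - b) via the surjection pi with kernel (aX - b) *)
  (forall y : A', exists f, pi f = y) ->
  (forall f, pi f = 0 <-> exists g, f = (a%:P * 'X - b%:P) * g) ->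
  krull A ->
  (* (i) *)
  a != 0 -> b != 0 ->
  (forall x, dvdR a x -> dvdR b x -> dvdR (a * b) x) ->
  (unitR a \/ exists s : seq A, (forall p, List.In p s -> prime_elt p) /\
                                a = \prod_(p <- s) p) ->
  (* (ii) *)
  (forall p, PAB a b p -> prime_ideal (gen2 p b)) ->
  (* (iii) *)
  (forall p q, PAB a b p -> PAB a b q -> ~ assocR p q -> ~ gen2 p b q) ->
  (* (iv) *)
  (forall p, PAB a b p -> forall x, (forall i, ideal_pow (gen2 p b) i x) -> x = 0) ->
  (krull A' /\ cl_iso A A') /\ (ufd A' <-> ufd A).
Proof.
move=> surj ker kA a0 b0 cop fac hii hiii hiv.
have [u [s [uu [sp ea]]]] : exists u (s : seq A), unitR u /\
    (forall p, List.In p s -> prime_elt p) /\ a = u * \prod_(p <- s) p.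
  case: fac => [ua|[s [hs ea]]].
    by exists a, [::]; split=> //; split=> //; rewrite big_nil mulr1.
  exists 1, s; split; first exact: dvdR_refl.
  by split=> //; rewrite mul1r.
have sa p : List.In p s -> dvdR p a.
  move=> /In_mem/perm_to_rem/(perm_big _) /= e; rewrite ea e big_cons.
  exact/dvdR_mull/dvdR_mulr/dvdR_refl.
pose f := base pi.
have f0 := base_eq0 ker a0 b0.
have ff := base_frac surj ker.
have domS := quotient_domain surj ker a0 b0 cop.
have a0' : a <> 0 by exact/eqP.
have fuu : unitR (f u).
  by have [w ew] := uu; exists (f w); rewrite -(rmorph1 f) ew rmorphM.
have mapP q : List.In q (map f s) -> exists p, List.In p s /\ q = f p.
  by move=> /List.in_map_iff [p [<- hp]]; exists p.
have hp p : List.In p s -> unitR (f p) \/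
    prime_elt (f p) /\ forall z, (forall n, dvdR (f p ^+ n) z) -> z = 0.
  move=> ps; have [pp pa] := (sp _ ps, sa _ ps); have [p0 _] := pp.
  have [hu|nu] := pselect (exists x y, p * x + b * y = 1).
    by left; exact: base_unit ker _ pa hu.
  right; have pab : PAB a b p by [].
  have pI := hii _ pab; have [[_ [ID IM]] [I1 PM]] := pI.
  split; first exact: (base_prime surj ker a0 b0).
  have [|e [a1 [es Ia1]]] := split_prime_power (s := s) pI p0.
    move=> q qs; have [|nas] := pselect (assocR p q); [by left|right].
    have [qab|nq] := pselect (PAB a b q); first exact: hiii.
    (* A factor q not in [PAB] is comaximal with b, so q in (p, b) would make that ideal the whole
       ring. *)
    have [x [y exy]] : exists x y, q * x + b * y = 1.
      apply: contrapT => h; apply: nq; split; first exact: sp.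
      by split=> //; exact: sa.
    move=> Iq; apply: I1; rewrite -exy; apply: ID; first by rewrite mulrC; exact: IM.
    by exists 0, y; rewrite mulr0 add0r.
  have Iua1 : ~ gen2 p b (u * a1).
    by move=> /PM [] //; exact: unit_notin_prime_ideal.
  have ea' : a = p ^+ e * (u * a1) by rewrite ea es mulrCA.
  (* If e were 0, a itself would lie outside (p, b), although p divides it. *)
  have e0 : (0 < e)%N.
    case: e {es} ea' => // ea'; case: Iua1; move: ea'; rewrite mul1r => <-.
    by have [c ->] := pa; exists c, 0; rewrite mulr0 addr0.
  exact: (base_separated surj ker a0 b0 cop p0 pI e0 ea' Iua1 (hiv _ pab)).
have fa : f a = f u * \prod_(p <- map f s) p.
  by rewrite big_map [in LHS]ea rmorphM rmorph_prod.
have kS : krull A'.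
  apply: (krull_extension (t := map f s) kA domS f0 ff _ fuu fa).
    by move=> /f0.
  by move=> q /mapP [p [/hp h ->]].
have iso : cl_iso A A'.
  apply: (nagata_cl_iso kA kS a0' f0 ff).
    move=> P [pP _] Pa; move: (Pa); rewrite ea => /(proj2 (proj2 pP)) [|].
      by move=> /(unit_notin_prime_ideal pP uu).
    by move=> /(prime_ideal_prod pP) [p [ps Pp]]; exists p; split=> //; exact: sp.
  (* Q contains the image of some prime factor of a; as Q is proper, that factor is not one that
     became a unit. *)
  move=> Q [pQ _]; rewrite -/f fa => /(proj2 (proj2 pQ)) [|].
    by move=> /(unit_notin_prime_ideal pQ fuu).
  move=> /(prime_ideal_prod pQ) [q [/mapP [p [/hp h ->]] Qp]].
  have [/(unit_notin_prime_ideal pQ) //|[pp _]] := h.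
  by exists (f p).
by split=> //; exact: cl_iso_ufd.
Qed.
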